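(* Assume that a saddle point exists ($\mathcal{M}^*\neq\emptyset$), that each $f_i:\mathbb{R}^n\to\mathbb{R}$ is convex and differentiable with $L_i$-Lipschitz continuous gradient, and that each $g_i:\mathbb{R}^p\to(-\infty,+\infty]$ is convex, proper and closed ($i=1,\dots,m$). Assume the step-size condition $0<\tau_i<2/L_i$ and $0<\tau_i\beta<1$ for $i=1,\dots,m$. Let $\{\mathbf{w}^k\}$, $\mathbf{w}^k=(\mathbf{x}^k,\mathbf{y}^k)$, be the sequence generated by DISA. Then there exists $\mathbf{w}^{\infty}\in\mathcal{M}^*$ such that $\lim_{k\to\infty}\mathbf{w}^k=\mathbf{w}^{\infty}$. Moreover, writing $\mathbf{x}^k=(\mathrm{x}_1^k,\mathrm{x}_2^k)$ with $\mathrm{x}_1^k\in\mathbb{R}^{mn}$, $\mathrm{x}_2^k\in\mathbb{R}^{mp}$, one has $\lim_{k\to\infty}\mathrm{x}_1^k=1_m\otimes \mathrm{x}^{\infty}$, where $\mathrm{x}^{\infty}\in\mathbb{R}^n$ solves the problem $\min_{\mathrm{x}\in\mathbb{R}^n}\sum_{i=1}^m\big(f_i(\mathrm{x})+g_i(U_i\mathrm{x})\big)$.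
   Context: Network and problem. $\mathcal{G}=(\mathcal{V},\mathcal{E})$ is an undirected connected graph with $m$ nodes. $W=[W_{ij}]\in\mathbb{R}^{m\times m}$ is symmetric and doubly stochastic with $\mathrm{null}(I-W)=\mathrm{Span}(1_m)$ ($1_m$ the all-ones vector), $W_{ij}=0$ if $i\neq j$ and $(i,j)\notin\mathcal{E}$, and $W_{ij}>0$ otherwise; consequently $1$ is a simple eigenvalue of $W$ and all other eigenvalues lie in $(-1,1)$. $U_i\in\mathbb{R}^{p\times n}$ are given matrices, $L_i>0$. Lifted form. For $\mathbf{x}=(\mathrm{x}_1,\mathrm{x}_2)\in\mathbb{R}^{mn}\times\mathbb{R}^{mp}=\mathbb{R}^{m(n+p)}$ with blocks $\mathrm{x}_{1,i}\in\mathbb{R}^n$, $\mathrm{x}_{2,i}\in\mathbb{R}^p$, let $F(\mathbf{x})=\sum_{i=1}^m f_i(\mathrm{x}_{1,i})$, $G(\mathbf{x})=\sum_{i=1}^m g_i(\mathrm{x}_{2,i})$, $\mathbf{V}=\frac12(I-W)\otimes I_n$, $\mathbf{U}=\mathrm{diag}\{U_1,\dots,U_m\}$ and $$\mathbf{B}=\begin{pmatrix}\sqrt{\mathbf{V}}&0\\ \mathbf{U}&-I\end{pmatrix},$$ where $\sqrt{\mathbf V}$ is the positive semidefinite square root. The Lagrangian is $\mathcal{L}(\mathbf{x},\mathbf{y})=F(\mathbf{x})+G(\mathbf{x})+\langle\mathbf{y},\mathbf{B}\mathbf{x}\rangle$, $\mathbf{y}\in\mathbb{R}^{m(n+p)}$.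 $\mathcal{M}^*$ is the set of saddle points $(\mathbf{x}^*,\mathbf{y}^* )$ of $\mathcal{L}$, i.e. $\mathcal{L}(\mathbf{x}^*,\mathbf{y})\le\mathcal{L}(\mathbf{x}^*,\mathbf{y}^* )\le\mathcal{L}(\mathbf{x},\mathbf{y}^* )$ for all $\mathbf{x},\mathbf{y}$. DISA. Given $\tau_i>0$, $\beta>0$, put $\tau=\max_i\tau_i$, $\Gamma_1=\mathrm{diag}\{\tau_1I_n,\dots,\tau_mI_n\}$, $\Gamma_2=\mathrm{diag}\{\tau_1I_p,\dots,\tau_mI_p\}$, $\Gamma=\mathrm{diag}\{\Gamma_1,\Gamma_2\}$, and $$\mathbf{Q}=\begin{pmatrix}\frac1\beta I&0\\0&\mathbf{S}\end{pmatrix},\qquad \mathbf{S}=2\Gamma_2+\mathbf{U}\Gamma_1\mathbf{U}^{\top}+\frac{\beta}{1-\tau\beta}\mathbf{U}\Gamma_1^2\mathbf{U}^{\top}.$$ For symmetric positive (semi)definite $H$, $\|z\|_H^2=\langle z,Hz\rangle$, and $\mathrm{prox}^{\Gamma^{-1}}_{G}(\mathbf{v})=\arg\min_{\mathbf{x}}\{G(\mathbf{x})+\frac12\|\mathbf{x}-\mathbf{v}\|^2_{\Gamma^{-1}}\}$. Starting from arbitrary $\mathbf{x}^0$ and $\mathbf{y}^0=0$, DISA iterates for $k\ge0$: $$\bar{\mathbf{x}}^{k+1}=\mathrm{prox}^{\Gamma^{-1}}_{G}\big(\mathbf{x}^k-\Gamma\nabla F(\mathbf{x}^k)-\Gamma\mathbf{B}^{\top}\mathbf{y}^k\big),$$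 $$\mathbf{y}^{k+1}=\arg\min_{\mathbf{y}}\Big\{\tfrac12\|\mathbf{y}-\mathbf{y}^k\|^2_{\mathbf{Q}}-\langle\mathbf{B}^{\top}\mathbf{y},\bar{\mathbf{x}}^{k+1}\rangle\Big\},$$ $$\mathbf{x}^{k+1}=\mathrm{prox}^{\Gamma^{-1}}_{G}\big(\mathbf{x}^k-\Gamma\nabla F(\mathbf{x}^k)-\Gamma\mathbf{B}^{\top}\mathbf{y}^{k+1}\big).$$ *)

(* Defs.v *)
From HB Require Import structures.
From mathcomp Require Import all_boot all_order all_algebra.
From mathcomp Require Import all_classical all_reals all_analysis.

Set Implicit Arguments.
Unset Strict Implicit.
Unset Printing Implicit Defensive.

Import Order.TTheory GRing.Theory Num.Theory.
Import numFieldNormedType.Exports.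

Local Open Scope classical_set_scope.
Local Open Scope ring_scope.

Section Euclidean.
Context {R : realType}.

Definition dot {N : nat} (u v : 'cV[R]_N) : R := (u^T *m v) 0 0.

(* The library norm on matrices is the sup norm; Lipschitz constants here refer
   to the Euclidean norm.  The induced topologies coincide. *)
Definition enorm {N : nat} (u : 'cV[R]_N) : R := Num.sqrt (dot u u).

(* [wnorm2 H z] is the squared weighted norm ||z||_H ^ 2. *)
Definition wnorm2 {N : nat} (H : 'M[R]_N) (z : 'cV[R]_N) : R := dot z (H *m z).

Definition gradient {N : nat} (h : 'cV[R]_N -> R) (x : 'cV[R]_N) : 'cV[R]_N :=
  \col_i 'D_(delta_mx i 0) h x.

Definition lipschitz_gradient {N : nat} (L : R) (h : 'cV[R]_N -> R) : Prop :=
  forall x y, enorm (gradient h x - gradient h y) <= L * enorm (x - y).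

Definition psdmx {N : nat} (S : 'M[R]_N) : Prop :=
  S^T = S /\ forall z : 'cV[R]_N, 0 <= dot z (S *m z).

(* The positive semidefinite square root of a positive semidefinite matrix V:
   there is exactly one S with the property below (otherwise the value is 0). *)
Definition sqrtmx {N : nat} (V : 'M[R]_N) : 'M[R]_N :=
  xget 0 [set S | psdmx S /\ S *m S = V].

Definition argmin {T : Type} (h : T -> \bar R) : set T :=
  [set x | forall z, (h x <= h z)%E].

(* Set-valued proximal mapping in the metric H. *)
Definition prox {N : nat} (H : 'M[R]_N) (G : 'cV[R]_N -> \bar R) (v : 'cV[R]_N)
    : set 'cV[R]_N :=
  argmin (fun x => (G x + (2^-1 * wnorm2 H (x - v))%:E)%E).

Definition epigraph {N : nat} (h : 'cV[R]_N -> \bar R) : set ('cV[R]_N * R) :=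
  [set z | (h z.1 <= z.2%:E)%E].

Record convex_proper_closed {N : nat} (h : 'cV[R]_N -> \bar R) : Prop := {
  cpc_gt_ninfty : forall x, (-oo < h x)%E ;
  cpc_convex : forall (t : R) (x y : 'cV[R]_N), 0 < t < 1 ->
    (h (t *: x + (1 - t) *: y)%R <= t%:E * h x + (1 - t)%:E * h y)%E ;
  cpc_proper : exists x, (h x < +oo)%E ;
  cpc_closed : closed (epigraph h) }.

End Euclidean.

Section Network.
Context {R : realType} {m : nat}.

Definition connected_graph (e : rel 'I_m) : Prop :=
  symmetric e /\ forall i j : 'I_m, connect e i j.

Record mixing_matrix (e : rel 'I_m) (W : 'M[R]_m) : Prop := {
  mix_sym : W^T = W ;
  mix_ge0 : forall i j, 0 <= W i j ;
  mix_row : forall i, \sum_j W i j = 1 ;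
  mix_col : forall j, \sum_i W i j = 1 ;
  mix_null : [set v : 'cV[R]_m | (1%:M - W) *m v = 0]
             = range (fun c : R => const_mx c) ;
  mix_zero : forall i j : 'I_m, i != j -> ~~ e i j -> W i j = 0 ;
  mix_pos : forall i j, i = j \/ e i j -> 0 < W i j }.

End Network.

(* R^{mn} and R^{mp} are rendered as stacked columns of m blocks, of height
   \sum_(i < m) n and \sum_(i < m) p, so that the block-matrix library applies;
   [submxcol x i] is the i-th block and 1_m (x) v is [\mxcol_(i < m) v]. *)
Notation lift_dim m n := (\sum_(i < m) n)%N.
Notation full_dim m n p := (lift_dim m n + lift_dim m p)%N.

Section DISA.
Context {R : realType} {m n p : nat}.
Variables (W : 'M[R]_m) (U : 'I_m -> 'M[R]_(p, n)).
Variables (f : 'I_m -> 'cV[R]_n -> R) (g : 'I_m -> 'cV[R]_p -> \bar R).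
Variables (tau : 'I_m -> R) (beta : R).

Definition Fsum (x : 'cV[R]_(full_dim m n p)) : R :=
  \sum_(i < m) f i (submxcol (usubmx x) i).

Definition Gsum (x : 'cV[R]_(full_dim m n p)) : \bar R :=
  (\sum_(i < m) g i (submxcol (dsubmx x) i))%E.

(* 1/2 (I - W) (x) I_n: block (i, j) is the scalar matrix 1/2 (I - W)_ij I_n. *)
Definition Vmx : 'M[R]_(lift_dim m n) :=
  2^-1 *: \mxblock_(i < m, j < m) (((1%:M - W) i j)%:M : 'M[R]_n).

(* [mxdiag] only allows square blocks. *)
Definition Umx : 'M[R]_(lift_dim m p, lift_dim m n) :=
  \mxblock_(i < m, j < m) (if i == j then U i else 0).

Definition Bmx : 'M[R]_(full_dim m n p) :=
  block_mx (sqrtmx Vmx) 0 Umx (- 1%:M).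

Definition lagrangian (x y : 'cV[R]_(full_dim m n p)) : \bar R :=
  ((Fsum x)%:E + Gsum x + (dot y (Bmx *m x))%:E)%E.

Definition saddle_points
    : set ('cV[R]_(full_dim m n p) * 'cV[R]_(full_dim m n p)) :=
  [set w | forall x y, (lagrangian w.1 y <= lagrangian w.1 w.2)%E
                    /\ (lagrangian w.1 w.2 <= lagrangian x w.2)%E].

Definition primal_objective (v : 'cV[R]_n) : \bar R :=
  (\sum_(i < m) ((f i v)%:E + g i (U i *m v)))%E.

(* The tau_i are positive, hence the neutral element 0. *)
Definition tau_max : R := \big[Num.max/0]_(i < m) tau i.

Definition Gamma1 : 'M[R]_(lift_dim m n) :=
  \mxdiag_(i < m) ((tau i)%:M : 'M[R]_n).
Definition Gamma2 : 'M[R]_(lift_dim m p) :=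
  \mxdiag_(i < m) ((tau i)%:M : 'M[R]_p).
Definition Gamma : 'M[R]_(full_dim m n p) := block_mx Gamma1 0 0 Gamma2.

Definition Smx : 'M[R]_(lift_dim m p) :=
  2 *: Gamma2 + Umx *m Gamma1 *m Umx^T
  + (beta / (1 - tau_max * beta)) *: (Umx *m (Gamma1 *m Gamma1) *m Umx^T).

Definition Qmx : 'M[R]_(full_dim m n p) := block_mx (beta^-1)%:M 0 0 Smx.

(* Both proximal steps evaluate the prox at this point, at the old and at the
   updated dual variable. *)
Definition forward_step (x y : 'cV[R]_(full_dim m n p))
    : 'cV[R]_(full_dim m n p) :=
  x - Gamma *m gradient Fsum x - Gamma *m Bmx^T *m y.

Record DISA_sequence (x xbar y : nat -> 'cV[R]_(full_dim m n p)) : Prop := {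
  disa_y0 : y 0%N = 0 ;
  disa_xbar : forall k,
    prox (invmx Gamma) Gsum (forward_step (x k) (y k)) (xbar k.+1) ;
  disa_y : forall k,
    argmin (fun z : 'cV[R]_(full_dim m n p) =>
              (2^-1 * wnorm2 Qmx (z - y k)
               - dot (Bmx^T *m z) (xbar k.+1))%:E) (y k.+1) ;
  disa_x : forall k,
    prox (invmx Gamma) Gsum (forward_step (x k) (y k.+1)) (x k.+1) }.

End DISA.

(* Main.v *)
Require Import Defs.
From HB Require Import structures.
From mathcomp Require Import all_boot all_order all_algebra.
From mathcomp Require Import all_classical all_reals all_analysis.
From mathcomp Require Import ring lra.

Set Implicit Arguments.
Unset Strict Implicit.
Unset Printing Implicit Defensive.

Import Order.TTheory GRing.Theory Num.Theory.
Import numFieldNormedType.Exports.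

Local Open Scope classical_set_scope.
Local Open Scope ring_scope.

(** A pair [(xs, ys)] is a saddle point exactly when [B xs = 0] and
    [- grad F (xs) - B^T ys] is a subgradient of [G] at [xs] (lemma
    [saddle_pointsP]).  The proximal steps and the dual step have optimality
    conditions of the same kind, all derived from one principle,
    [subgradient_of_argmin]: writing [P] for the inverse of [Gamma],
    [P (x - xb) - grad F (x) - B^T y] is a subgradient of [G] at the predicted
    point [xb], the same holds at the corrected point [x'] with the new dual
    variable [y'], and [Q (y' - y) = B xb].

    The energy relative to a saddle point is
    [|x - xs|_P ^ 2 + |y - ys|_Q ^ 2].  Testing the subgradient at [x'] with
    [xs], the one at [xb] with [x'], and the one at [xs] with [xb], and adding,
    gives the decrease of the energy up to two error terms ([energy_step]).  The
    first, [2 <xb - xs, grad F (x) - grad F (xs)>], is controlled by the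
    Baillon-Haddad inequality ([cocoercive]) at the price of
    [L i / 2 * |x_i - xb_i| ^ 2] in block [i], which the step-size condition
    [tau i < 2 / L i] pays for.  The second, [2 <xb - x', B^T (y' - y)>], is at
    most [|xb - x'|_P ^ 2 + |B^T (y' - y)|_Gamma ^ 2], and the matrix [S] is
    built so that [Q - B Gamma B^T] is positive definite ([Qmx_dominates]).
    Hence the energy drops by at least
    [c (|x - xb| ^ 2 + |y' - y| ^ 2)] for some [c > 0] ([energy_decrease]).

    The iterates are therefore bounded, [x k - xbar (k + 1)] and
    [y (k + 1) - y k] tend to 0, and every cluster point satisfies the limiting
    optimality conditions, because the subdifferential of a closed function has
    a closed graph ([subgradient_limit]) and the gradients are continuous.  So
    every cluster point is a saddle point; as the energy relative to it is
    nonincreasing, the whole sequence converges to it ([fejer_cvg]).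

    Finally [B x = 0] says that [sqrt V x1 = 0] and [x2 = U x1].  The square root
    of [V] exists because [1 - V] is entrywise nonnegative with row sums 1
    ([psdmx_sqrt_1sub]), it has the kernel of [V], and the kernel of [1 - W] is
    spanned by the all-ones vector; so [x1] is in consensus, and comparing the
    Lagrangian at the saddle point with its value at stacked copies of a
    candidate shows that the common value is optimal
    ([saddle_point_solution]). *)

(** * The Euclidean inner product *)

Section InnerProduct.
Context {R : realType}.

Lemma dotE {N} (u v : 'cV[R]_N) : dot u v = \sum_i u i 0 * v i 0.
Proof. by rewrite /dot mxE; apply: eq_bigr => i _; rewrite mxE. Qed.

Lemma dotC {N} (u v : 'cV[R]_N) : dot u v = dot v u.
Proof. by rewrite !dotE; apply: eq_bigr => i _; rewrite mulrC. Qed.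

Lemma dotDr {N} (u v w : 'cV[R]_N) : dot u (v + w) = dot u v + dot u w.
Proof. by rewrite /dot mulmxDr mxE. Qed.

Lemma dotZr {N} a (u v : 'cV[R]_N) : dot u (a *: v) = a * dot u v.
Proof. by rewrite /dot -scalemxAr mxE. Qed.

Lemma dotNr {N} (u v : 'cV[R]_N) : dot u (- v) = - dot u v.
Proof. by rewrite -scaleN1r dotZr mulN1r. Qed.

Lemma dotDl {N} (u v w : 'cV[R]_N) : dot (v + w) u = dot v u + dot w u.
Proof. by rewrite dotC dotDr !(dotC u). Qed.

Lemma dotZl {N} a (u v : 'cV[R]_N) : dot (a *: v) u = a * dot v u.
Proof. by rewrite dotC dotZr dotC. Qed.

Lemma dotNl {N} (u v : 'cV[R]_N) : dot (- v) u = - dot v u.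
Proof. by rewrite dotC dotNr dotC. Qed.

Definition dot_lin := (@dotDl, @dotDr, @dotZl, @dotZr, @dotNl, @dotNr).

Lemma dot0r {N} (u : 'cV[R]_N) : dot u 0 = 0.
Proof. by rewrite -(scale0r 0) dotZr mul0r. Qed.

Lemma dot0l {N} (u : 'cV[R]_N) : dot 0 u = 0.
Proof. by rewrite dotC dot0r. Qed.

Lemma dot_sumr {N} (I : finType) (u : 'cV[R]_N) (v : I -> 'cV[R]_N) :
  dot u (\sum_i v i) = \sum_i dot u (v i).
Proof. exact: (big_morph (dot u) (dotDr u) (dot0r u)). Qed.

Lemma dot_ge0 {N} (u : 'cV[R]_N) : 0 <= dot u u.
Proof. by rewrite dotE sumr_ge0 // => i _; rewrite -expr2 sqr_ge0. Qed.

Lemma dot_sqr_le {N} (u : 'cV[R]_N) i : u i 0 ^+ 2 <= dot u u.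
Proof.
rewrite dotE (bigD1 i) //= -expr2 lerDl sumr_ge0 // => j _.
by rewrite -expr2 sqr_ge0.
Qed.

Lemma dot_eq0 {N} (u : 'cV[R]_N) : dot u u = 0 -> u = 0.
Proof.
move=> u0; apply/colP => i; rewrite mxE; apply/eqP; rewrite -sqrf_eq0.
by rewrite eq_le sqr_ge0 -u0 dot_sqr_le.
Qed.

Lemma dot_mulmx {M N} (A : 'M[R]_(M, N)) (u : 'cV[R]_M) (v : 'cV[R]_N) :
  dot u (A *m v) = dot (A^T *m u) v.
Proof. by rewrite /dot trmx_mul trmxK mulmxA. Qed.

Lemma wnorm2D {N} (H : 'M[R]_N) (u v : 'cV[R]_N) : H^T = H ->
  wnorm2 H (u + v) = wnorm2 H u + 2 * dot u (H *m v) + wnorm2 H v.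
Proof.
move=> HT; rewrite /wnorm2 mulmxDr !dot_lin (dot_mulmx H v) HT (dotC _ u).
by ring.
Qed.

Lemma wnorm2Z {N} (H : 'M[R]_N) t (u : 'cV[R]_N) :
  wnorm2 H (t *: u) = t ^+ 2 * wnorm2 H u.
Proof. by rewrite /wnorm2 -scalemxAr !dot_lin expr2 mulrA. Qed.

Lemma wnorm2N {N} (H : 'M[R]_N) (u : 'cV[R]_N) : wnorm2 H (- u) = wnorm2 H u.
Proof. by rewrite -scaleN1r wnorm2Z sqrrN expr1n mul1r. Qed.

Lemma wnorm2_subC {N} (H : 'M[R]_N) (u v : 'cV[R]_N) :
  wnorm2 H (u - v) = wnorm2 H (v - u).
Proof. by rewrite -wnorm2N opprB. Qed.

Lemma wnorm2B {N} (H : 'M[R]_N) (u v : 'cV[R]_N) : H^T = H ->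
  wnorm2 H (u - v) = wnorm2 H u - 2 * dot u (H *m v) + wnorm2 H v.
Proof.
by move=> HT; rewrite wnorm2D// mulmxN dotNr wnorm2N mulrN.
Qed.

(** Polarization, which turns the inner products of the energy estimate into
    differences of squared distances. *)
Lemma three_point {N} (H : 'M[R]_N) (a b c : 'cV[R]_N) : H^T = H ->
  2 * dot (H *m (a - b)) (c - b) = wnorm2 H (a - b) + wnorm2 H (c - b)
                                   - wnorm2 H (a - c).
Proof.
move=> HT; rewrite (_ : a - c = (a - b) - (c - b)); last first.
  by rewrite opprB addrA subrK.
by rewrite (wnorm2B (a - b) (c - b) HT) dot_mulmx HT; ring.
Qed.

(** Young's inequality in dual weighted norms: expand
    [wnorm2 P (d - G *m w) >= 0]. *)
Lemma young_dual {N} (P G : 'M[R]_N) (d w : 'cV[R]_N) :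
  P^T = P -> P *m G = 1%:M -> (forall z, 0 <= wnorm2 P z) ->
  2 * dot d w <= wnorm2 P d + wnorm2 G w.
Proof.
move=> PT PG P0; have := P0 (d - G *m w).
rewrite wnorm2B // /wnorm2 !(mulmxA P G) PG !mul1mx (dotC (G *m w)); lra.
Qed.

(** Divide a first-order expansion by the step and let the step tend to 0. *)
Lemma ge0_of_small_steps (a b : R) :
  (forall t, 0 < t < 1 -> 0 <= a + t * b) -> 0 <= a.
Proof.
move=> h; rewrite leNgt; apply/negP => a0.
have b0 : 0 <= `|b| by [].
(* For [a < 0] this step satisfies [t * `|b| <= - a / 2]. *)
pose t := - a / (2 * (`|b| - a)).
have d0 : 0 < `|b| - a by lra.
have t0 : 0 < t by rewrite /t divr_gt0 //; lra.
have t1 : t < 1 by rewrite /t ltr_pdivrMr ?mulr_gt0//; lra.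
have tE : t * (2 * (`|b| - a)) = - a by rewrite /t divfK // gt_eqF // mulr_gt0.
have /h : 0 < t < 1 by rewrite t0.
have := ler_wpM2l (ltW t0) (ler_norm b); nra.
Qed.

End InnerProduct.

(** * Subgradients of extended-valued convex functions *)

Section Subgradient.
Context {R : realType}.

Definition subgradient {N} (h : 'cV[R]_N -> \bar R) (x u : 'cV[R]_N) : Prop :=
  h x \is a fin_num /\ forall z, (h x + (dot u (z - x))%:E <= h z)%E.

(** First-order optimality for smooth plus convex: compare the minimizer [x]
    with the segment points [x + t (z - x)], divide by [t] and let [t] tend to
    0.  Only the one-sided quadratic upper bound [phi_up] on the smooth part is
    used, which covers squared weighted distances and functions with Lipschitz
    gradient alike. *)
Lemma subgradient_of_argmin {N} (h : 'cV[R]_N -> \bar R) (phi : 'cV[R]_N -> R)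
    (q : 'cV[R]_N -> R) (s x : 'cV[R]_N) :
  (forall z, (-oo < h z)%E) ->
  (forall (t : R) (a b : 'cV[R]_N), 0 < t < 1 ->
    (h (t *: a + (1 - t) *: b)%R <= t%:E * h a + (1 - t)%:E * h b)%E) ->
  (exists z, (h z < +oo)%E) ->
  (forall (t : R) (d : 'cV[R]_N), 0 < t < 1 ->
    phi (x + t *: d) <= phi x + t * dot s d + t ^+ 2 * q d) ->
  argmin (fun z => (h z + (phi z)%:E)%E) x ->
  subgradient h x (- s).
Proof.
move=> hN hC [z0 z0f] phi_up xmin.
have hx : h x \is a fin_num.
  have := xmin z0; case: (h x) (hN x) => [r||]// _.
  by case: (h z0) z0f (hN z0) => [c||].
split=> // z; case E : (h z) (hN z) => [c||//] _; last by rewrite leey.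
move: E; rewrite -(fineK hx); set b := fine (h x) => E.
rewrite -EFinD lee_fin dotNl.
suff : 0 <= (c - b + dot s (z - x)) by lra.
apply: (@ge0_of_small_steps _ _ (q (z - x))) => t t01.
have := xmin (x + t *: (z - x)).
have : (h (x + t *: (z - x))%R <= (t * c + (1 - t) * b)%:E)%E.
  have := hC t z x t01; rewrite E -(fineK hx) -/b -!EFinM -EFinD.
  by rewrite scalerBr scalerBl scale1r addrCA.
rewrite -(fineK hx) -/b.
move: (hN (x + t *: (z - x))).
case: (h (x + t *: (z - x))) => [r||]// _; rewrite -!EFinD !lee_fin.
move=> h1 h2; have h3 := phi_up t (z - x) t01.
have [t0 _] := andP t01.
have : 0 <= t * (c - b + dot s (z - x) + t * q (z - x)) by nra.
by rewrite pmulr_rge0.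
Qed.

Lemma wnorm2_line {N} (H : 'M[R]_N) (x v d : 'cV[R]_N) t : H^T = H ->
  2^-1 * wnorm2 H (x + t *: d - v)
  = 2^-1 * wnorm2 H (x - v) + t * dot (H *m (x - v)) d
    + t ^+ 2 * (2^-1 * wnorm2 H d).
Proof.
move=> HT; rewrite (addrAC x) (wnorm2D (x - v)) // wnorm2Z -scalemxAr dotZr.
by rewrite (dot_mulmx H) HT; field.
Qed.

Lemma subgradient_prox {N} (H : 'M[R]_N) (h : 'cV[R]_N -> \bar R) v x :
  H^T = H -> (forall z, (-oo < h z)%E) ->
  (forall (t : R) (a b : 'cV[R]_N), 0 < t < 1 ->
    (h (t *: a + (1 - t) *: b)%R <= t%:E * h a + (1 - t)%:E * h b)%E) ->
  (exists z, (h z < +oo)%E) ->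
  prox H h v x -> subgradient h x (H *m (v - x)).
Proof.
move=> HT hN hC hP hx; rewrite -(opprB x v) mulmxN.
apply: (subgradient_of_argmin (q := fun d => 2^-1 * wnorm2 H d) hN hC hP _ hx).
by move=> t d _; rewrite wnorm2_line.
Qed.

(** The optimality condition of the dual update, an instance of
    [subgradient_of_argmin] with a vanishing nonsmooth part. *)
Lemma argmin_quadratic {N} (H : 'M[R]_N) (y b x : 'cV[R]_N) : H^T = H ->
  argmin (fun z => (2^-1 * wnorm2 H (z - y) - dot b z)%:E) x ->
  H *m (x - y) = b.
Proof.
move=> HT xmin.
suff [_ /(_ (x - (H *m (x - y) - b)))] :
    subgradient (fun=> 0%E) x (- (H *m (x - y) - b)).
  rewrite add0e lee_fin (addrAC x) subrr add0r dotNl dotNr opprK => le0.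
  by apply/eqP; rewrite -subr_eq0; apply/eqP/dot_eq0/le_anti; rewrite le0 dot_ge0.
apply: (subgradient_of_argmin (phi := fun z => 2^-1 * wnorm2 H (z - y) - dot b z)
          (q := fun d => 2^-1 * wnorm2 H d)) => //.
- by move=> t a c _; rewrite !mule0 adde0.
- by move=> t d _; rewrite wnorm2_line // !dot_lin; lra.
- by move=> z; rewrite !add0e; exact: xmin.
Qed.

End Subgradient.

(** * Convergence of sequences of column vectors *)

Section ColumnLimits.
Context {R : realType}.

Lemma cvg_colP {T : Type} {F : set_system T} {FF : Filter F} {N}
    (u : T -> 'cV[R]_N) (a : 'cV[R]_N) :
  u @ F --> a <-> forall i, (fun k => u k i 0) @ F --> a i 0.
Proof.
split=> [ua i|ua].
  exact: (cvg_comp u (fun M : 'cV[R]_N => M i 0) ua (@coord_continuous _ _ _ i 0 a)).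
apply/cvg_ballP => e e0.
have : \forall k \near F, forall i, ball (a i 0) e (u k i 0).
  by apply: filter_forall => i; move/cvg_ballP: (ua i); apply.
by apply: filterS => k h; split=> // i j; rewrite ord1.
Qed.

Section Filter.
Context {T : Type} {F : set_system T} {FF : Filter F}.

Lemma cvg_fsum (I : finType) (u : I -> T -> R) (a : I -> R) :
  (forall i, u i @ F --> a i) ->
  (fun k => \sum_i u i k) @ F --> \sum_i a i.
Proof. by move=> ua; apply: cvg_big => // x; exact: add_continuous. Qed.

Lemma cvg_dot {N} (u v : T -> 'cV[R]_N) a b :
  u @ F --> a -> v @ F --> b -> (fun k => dot (u k) (v k)) @ F --> dot a b.
Proof.
move=> /cvg_colP ua /cvg_colP vb; under eq_fun do rewrite dotE.
by rewrite dotE; apply: cvg_fsum => i; apply: cvgM.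
Qed.

Lemma cvg_mulmx {M N} (A : 'M[R]_(M, N)) (u : T -> 'cV[R]_N) a :
  u @ F --> a -> (fun k => A *m u k) @ F --> A *m a.
Proof.
move=> /cvg_colP ua; apply/cvg_colP => i; under eq_fun do rewrite mxE.
by rewrite mxE; apply: cvg_fsum => j; apply: cvgM => //; exact: cvg_cst.
Qed.

(** Euclidean distances dominate the coordinates, hence the sup norm that
    defines the topology. *)
Lemma cvg_of_sqr_dist {N} (u : T -> 'cV[R]_N) a (e : T -> R) :
  (forall k, dot (u k - a) (u k - a) <= e k) -> e @ F --> (0 : R) -> u @ F --> a.
Proof.
move=> ue e0; apply/cvg_colP => i.
apply/subr_cvg0/norm_cvg0P.
apply: (@squeeze_cvgr _ _ _ _ (fun=> 0) (fun k => Num.sqrt (e k))).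
- apply: nearW => k; rewrite normr_ge0 /= -sqrtr_sqr ler_wsqrtr //.
  by apply: le_trans (ue k); have := dot_sqr_le (u k - a) i; rewrite !mxE.
- exact: cvg_cst.
- rewrite -(sqrtr0 R).
  exact: (cvg_comp e Num.sqrt e0 (@sqrt_continuous R 0)).
Qed.

End Filter.

(** Along an ultrafilter a bounded sequence of vectors converges outright:
    this replaces the extraction of convergent subsequences. *)
Lemma ultra_bounded_cvg {T : Type} {F : set_system T} {N}
    (u : T -> 'cV[R]_N) (C : R) :
  UltraFilter F -> (forall k, dot (u k) (u k) <= C) ->
  exists a : 'cV[R]_N, u @ F --> a.
Proof.
move=> FU uC; have FP : ProperFilter F by exact: ultra_proper.
have real_case (r : T -> R) : (forall k, r k ^+ 2 <= C) -> exists c : R, r @ F --> c.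
  move=> rC.
  have [|c [_ cc]] := @segment_compact R (- Num.sqrt C) (Num.sqrt C) (r @ F) _.
    apply: nearW => k; rewrite /= in_itv /= -ler_norml -sqrtr_sqr.
    by rewrite ler_wsqrtr.
  exists c => B cB.
  have [//|rB] := @in_ultra_setVsetC _ F (r @^-1` B) FU.
  by have [y [nBy By]] := cc (~` B) B rB cB.
have /choice[a ua] : forall i, exists c : R, (fun k => u k i 0) @ F --> c.
  by move=> i; apply: real_case => k; exact: le_trans (dot_sqr_le _ _) (uC k).
by exists (\col_i a i); apply/cvg_colP => i; rewrite mxE.
Qed.

(** The dissipation [d] is squeezed between 0 and the consecutive differences of
    the convergent sequence [e]. *)
Lemma decrease_cvg0 (e d : nat -> R) :
  (forall k, 0 <= e k) -> (forall k, 0 <= d k) ->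
  (forall k, e k.+1 + d k <= e k) -> d @ \oo --> (0 : R).
Proof.
move=> e0 d0 ed.
have ei : {homo e : n m / (n <= m)%N >-> m <= n}.
  by apply/nonincreasing_seqP => k; apply: le_trans (ed k); rewrite lerDl.
have ec : cvgn e.
  by apply: nonincreasing_is_cvgn => //; exists 0 => _ [k _ <-].
apply: (@squeeze_cvgr _ _ _ _ (fun=> 0) (fun k => e k - e k.+1)).
- by apply: nearW => k; rewrite d0 /=; have := ed k; lra.
- exact: cvg_cst.
- by rewrite -(subrr (limn e)); apply: cvgB => //; rewrite cvg_shiftS.
Qed.

(** Fejer monotonicity.  Boundedness gives a cluster point along an
    ultrafilter; by hypothesis it lies in [Z], so the energy relative to that
    very point is nonincreasing, and its limit can be read off along the
    ultrafilter, where it is 0. *)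
Lemma fejer_cvg {N} (P Q : 'M[R]_N) (alpha : R)
    (Z : set ('cV[R]_N * 'cV[R]_N)) (x y : nat -> 'cV[R]_N) :
  0 < alpha ->
  (forall z, alpha * dot z z <= wnorm2 P z) ->
  (forall z, alpha * dot z z <= wnorm2 Q z) ->
  Z !=set0 ->
  (forall w, Z w -> forall k,
    wnorm2 P (x k.+1 - w.1) + wnorm2 Q (y k.+1 - w.2)
    <= wnorm2 P (x k - w.1) + wnorm2 Q (y k - w.2)) ->
  (forall (F : set_system nat), ProperFilter F -> \oo `<=` F ->
    forall (a b : 'cV[R]_N), x @ F --> a -> y @ F --> b -> Z (a, b)) ->
  exists w, [/\ Z w, x @ \oo --> w.1 & y @ \oo --> w.2].
Proof.
move=> alpha0 aP aQ [w0 Zw0] mono clus.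
have P0 z : 0 <= wnorm2 P z.
  by apply: le_trans (aP z); rewrite mulr_ge0 ?dot_ge0 // ltW.
have Q0 z : 0 <= wnorm2 Q z.
  by apply: le_trans (aQ z); rewrite mulr_ge0 ?dot_ge0 // ltW.
pose E (w : 'cV[R]_N * 'cV[R]_N) k := wnorm2 P (x k - w.1) + wnorm2 Q (y k - w.2).
have xE w k : dot (x k - w.1) (x k - w.1) <= alpha^-1 * E w k.
  by rewrite mulrC ler_pdivlMr // mulrC (le_trans (aP _)) // lerDl.
have yE w k : dot (y k - w.2) (y k - w.2) <= alpha^-1 * E w k.
  by rewrite mulrC ler_pdivlMr // mulrC (le_trans (aQ _)) // lerDr.
have E_le w k : Z w -> E w k <= E w 0%N.
  by move=> Zw; elim: k => // k; apply: le_trans; exact: mono.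
have [F [FU ooF]] := ultraFilterLemma (eventually_filter).
have FP : ProperFilter F by exact: ultra_proper.
have bound (u : nat -> 'cV[R]_N) c :
    (forall k, dot (u k - c) (u k - c) <= alpha^-1 * E w0 k) ->
    exists a : 'cV[R]_N, u @ F --> a.
  move=> uE.
  have [k|a ua] := @ultra_bounded_cvg _ F N (fun k => u k - c)
                     (alpha^-1 * E w0 0%N) FU.
    by apply: le_trans (uE k) _; rewrite ler_pM2l ?invr_gt0 // E_le.
  exists (a + c); rewrite [u](_ : _ = fun k => (u k - c) + c).
    by apply: cvgD => //; exact: cvg_cst.
  by apply/funext => k; rewrite subrK.
have [a xa] := bound x w0.1 (xE w0).
have [b yb] := bound y w0.2 (yE w0).
have Zab := clus F FP ooF a b xa yb.
have EF : E (a, b) @ F --> (0 : R).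
  have sub (u : nat -> 'cV[R]_N) (c : 'cV[R]_N) :
      u @ F --> c -> (fun k => u k - c) @ F --> (0 : 'cV[R]_N).
    by move=> uc; rewrite -(subrr c); apply: cvgB => //; exact: cvg_cst.
  rewrite -(addr0 0) -{1}(dot0l (P *m 0)) -(dot0l (Q *m 0)).
  by apply: cvgD; (apply: cvg_dot; [|apply: cvg_mulmx]); exact: sub.
have Ei : {homo E (a, b) : n m / (n <= m)%N >-> m <= n}.
  by apply/nonincreasing_seqP => k; exact: mono.
have Ec : cvgn (E (a, b)).
  apply: nonincreasing_is_cvgn => //.
  by exists 0 => _ [k _ <-]; rewrite addr_ge0.
have E0 : E (a, b) @ \oo --> (0 : R).
  suff <- : limn (E (a, b)) = 0 by [].
  apply: (@cvg_unique _ (@Rhausdorff R) (E (a, b) @ F)) EF.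
  by apply: cvg_trans Ec => B; exact: ooF.
have E0' : (fun k => alpha^-1 * E (a, b) k) @ \oo --> (0 : R).
  by rewrite -(mulr0 alpha^-1); apply: cvgM => //; exact: cvg_cst.
by exists (a, b); split=> //; [apply: cvg_of_sqr_dist E0' => k; exact: (xE (a, b))|
  apply: cvg_of_sqr_dist E0' => k; exact: (yE (a, b))].
Qed.

End ColumnLimits.

(** * Smooth convex functions *)

Section SmoothConvex.
Context {R : realType} {N : nat}.
Implicit Types (f : 'cV[R]_N -> R) (x v z : 'cV[R]_N).

Lemma col_sum_delta x : x = \sum_i x i 0 *: delta_mx i 0.
Proof.
by rewrite [x in LHS]matrix_sum_delta; apply: eq_bigr => i _; rewrite big_ord1.
Qed.

(** For a differentiable function the partial derivatives collected in
    [gradient] determine all directional derivatives. *)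
Lemma derive_gradient f x v : differentiable f x -> 'D_v f x = dot (gradient f x) v.
Proof.
move=> df; rewrite deriveE // [v in LHS]col_sum_delta linear_sum dotE.
by apply: eq_bigr => i _; rewrite linearZ /= mxE deriveE // mulrC.
Qed.

Lemma is_derive_line f x v (t : R) : differentiable f (t *: v + x) ->
  is_derive t 1 (fun s : R => f (s *: v + x)) (dot (gradient f (t *: v + x)) v).
Proof.
move=> df.
have E : (fun h : R => h^-1 *: (((fun s : R => f (s *: v + x)) \o shift t) (h *: 1)
            - f (t *: v + x)))
       = (fun h => h^-1 *: ((f \o shift (t *: v + x)) (h *: v) - f (t *: v + x))).
  by apply/funext => h /=; rewrite scalerDl scaler1 addrA.
apply: DeriveDef; first by rewrite /derivable E; exact: diff_derivable.
by rewrite /derive E -derive_gradient.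
Qed.

(** By convexity the difference quotients in the direction [z - x], for positive
    steps up to 1, are at most [f z - f x]. *)
Lemma convex_gradient_le f x z : convex_function setT f -> differentiable f x ->
  f x + dot (gradient f x) (z - x) <= f z.
Proof.
move=> fC df; rewrite addrC -lerBrDr -derive_gradient //.
have /cvg_dnbhs_at_right/cvgr_to_le lim_le :
    (fun h => h^-1 *: ((f \o shift x) (h *: (z - x)) - f x)) @ 0^'
    --> 'D_(z - x) f x by exact: diff_derivable.
apply: lim_le; near=> h.
have h0 : 0 < h by near: h; exact: nbhs_right_gt.
have h1 : h <= 1 by near: h; apply: nbhs_right_le; exact: ltr01.
rewrite /= [_ *: _]mulrC ler_pdivrMr //.
have fh : f (h *: z + (1 - h) *: x) <= h * f z + (1 - h) * f x.
  by apply: (fC (Itv01 (ltW h0) h1) z x); rewrite inE.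
have hE : h *: z + (1 - h) *: x = h *: (z - x) + x.
  by rewrite scalerBl scalerBr scale1r addrA addrAC.
by rewrite -hE; lra.
Unshelve. all: by end_near. Qed.

Lemma lipschitz_sqr L f x z : 0 < L -> lipschitz_gradient L f ->
  dot (gradient f x - gradient f z) (gradient f x - gradient f z)
  <= L ^+ 2 * dot (x - z) (x - z).
Proof.
move=> L0 /(_ x z) h.
rewrite -[leLHS]sqr_sqrtr ?dot_ge0 // -[X in _ * X]sqr_sqrtr ?dot_ge0 // -exprMn.
by rewrite lerXn2r // ?nnegrE ?mulr_ge0 ?sqrtr_ge0 ?(ltW L0).
Qed.

(** The descent lemma: along the segment the difference of the two sides has
    derivative at most 0, by the Lipschitz bound and Young's inequality. *)
Lemma descent_lemma L f x v : 0 < L -> (forall z, differentiable f z) ->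
  lipschitz_gradient L f ->
  f (v + x) <= f x + dot (gradient f x) v + L / 2 * dot v v.
Proof.
move=> L0 df fL.
pose psi (t : R) := f (t *: v + x) - (t * dot (gradient f x) v + t * t * (L / 2 * dot v v)).
have dpsi (t : R) : is_derive t 1 psi
    (dot (gradient f (t *: v + x)) v - (dot (gradient f x) v + t * (L * dot v v))).
  have d1 := is_derive_line (df (t *: v + x)).
  apply: is_derive_eq.
  rewrite /GRing.scale /=. by field.
suff : psi 1 <= psi 0.
  by rewrite /psi scale1r scale0r add0r !mul0r !mul1r; lra.
apply: (@ler0_derive1_nincr _ psi 0 1) => //.
- move=> t /[!in_itv] /= /andP[t0 t1]; rewrite derive1E derive_val.
  have := @lipschitz_sqr L f (t *: v + x) x L0 fL; rewrite addrK dotZl dotZr.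
  set d := gradient f (t *: v + x) - gradient f x.
  have -> : gradient f (t *: v + x) = d + gradient f x by rewrite subrK.
  clearbody d; have := dot_ge0 (d - (L * t) *: v).
  rewrite (dotDl v) !dot_lin (dotC v d).
  move: (dot d d) (dot d v) (dot v v) (dot (gradient f x) v) => D a c b h1 h2.
  suff : 0 <= (L * t) * (t * (L * c) - a) by rewrite pmulr_rge0 ?mulr_gt0 //; lra.
  lra.
- apply: derivable_within_continuous => t _; exact: ex_derive.
Qed.

(** Baillon-Haddad: comparing the gradient inequality at [x] with the descent
    lemma at [z], both at the point reached from [z] by a gradient step of the
    tilted function, gains [|gradient difference|^2 / (2 L)]; then exchange
    [x] and [z] and add. *)
Lemma cocoercive L f x z : 0 < L -> convex_function setT f ->
  (forall z, differentiable f z) -> lipschitz_gradient L f ->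
  dot (gradient f x - gradient f z) (gradient f x - gradient f z)
  <= L * dot (gradient f x - gradient f z) (x - z).
Proof.
move=> L0 fC df fL.
have half a b : dot (gradient f b - gradient f a) (gradient f b - gradient f a)
    <= 2 * L * (f b - f a - dot (gradient f a) (b - a)).
  set d := gradient f b - gradient f a.
  (* The point [b - d / L] is a gradient step for [f - dot (gradient f a)]. *)
  have := @convex_gradient_le f a (- L^-1 *: d + b) fC (df a).
  have := @descent_lemma L f b (- L^-1 *: d) L0 df fL.
  rewrite -(addrA (- L^-1 *: d)) (dotDr (gradient f a) (- L^-1 *: d)) !dotZl !dotZr.
  have -> : gradient f b = d + gradient f a by rewrite /d subrK.
  rewrite dotDl.
  move: (dot d d) (dot (gradient f a) d) (dot (gradient f a) (b - a)) => D g1 g2.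
  move=> h1 h2.
  have {h1 h2} : 0 <= f b - f a - g2 - L^-1 * D + L / 2 * (L^-1 * (L^-1 * D)) by lra.
  rewrite (_ : L / 2 * (L^-1 * (L^-1 * D)) = L^-1 * D / 2); last first.
    by field; rewrite gt_eqF.
  rewrite -(pmulr_rge0 _ L0) => h.
  have LD : L * (L^-1 * D) = D by rewrite mulrA mulfV ?mul1r // gt_eqF.
  lra.
have := half x z; have := half z x.
rewrite -(opprB (gradient f x)) dotNl dotNr opprK -(opprB x) dotNr opprK.
rewrite (dotDl (x - z) (gradient f x)) dotNl.
lra.
Qed.

End SmoothConvex.


(** * Limits of subgradients and the energy estimate *)

Section SubgradientInequalities.
Context {R : realType}.

(** The points [(x k, h z - dot (u k) (z - x k))] lie in the epigraph of [h];
    their limit does too, since the epigraph is closed. *)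
Lemma subgradient_limit {T : Type} {F : set_system T} {N}
    (h : 'cV[R]_N -> \bar R) (x u : T -> 'cV[R]_N) a b :
  ProperFilter F -> convex_proper_closed h ->
  (forall k, subgradient h (x k) (u k)) -> x @ F --> a -> u @ F --> b ->
  subgradient h a b.
Proof.
move=> FP hcpc hxu xa ub.
have hN := cpc_gt_ninfty hcpc.
have key z c : h z = c%:E -> (h a <= (c - dot b (z - a))%:E)%E.
  move=> hz.
  have rc : (fun k => c - dot (u k) (z - x k)) @ F --> c - dot b (z - a).
    apply: cvgB; first exact: cvg_cst.
    by apply: cvg_dot => //; apply: cvgB => //; exact: cvg_cst.
  apply: (@closed_cvg _ _ F FP (fun k => (x k, c - dot (u k) (z - x k)))
            _ (cpc_closed hcpc) _ (a, c - dot b (z - a))).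
    apply: nearW => k; rewrite /epigraph /=; have [hx] := hxu k => /(_ z).
    by rewrite hz -(fineK hx) -EFinD !lee_fin; lra.
  exact: (cvg_pair xa rc).
have ha : h a \is a fin_num.
  rewrite fin_real // hN /=.
  have [z zf] := cpc_proper hcpc.
  move: zf (hN z); case E : (h z) => [c||]// _ _.
  exact: le_lt_trans (key _ _ E) (ltry _).
split=> // z; case E : (h z) (hN z) => [c||]// _; last by rewrite leey.
by have := key _ _ E; rewrite -(fineK ha) -EFinD !lee_fin; lra.
Qed.

(** Three subgradient inequalities are combined: the corrected point [x'] is
    tested at the solution [xs], the predicted point [xb] at [x'], and the
    solution at [xb].  The values of [h] cancel, the gradients only meet
    [xb - xs], and the dual terms collapse because [Q (y' - y) = B xb] and
    [B xs = 0]. *)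
Lemma energy_step {N} (h : 'cV[R]_N -> \bar R) (P Q B : 'M[R]_N)
    (x xb x' xs y y' ys a s : 'cV[R]_N) :
  P^T = P -> Q^T = Q ->
  subgradient h xb (P *m (x - xb) - a - B^T *m y) ->
  subgradient h x' (P *m (x - x') - a - B^T *m y') ->
  subgradient h xs (- s - B^T *m ys) ->
  Q *m (y' - y) = B *m xb -> B *m xs = 0 ->
  wnorm2 P (x' - xs) + wnorm2 Q (y' - ys)
  <= wnorm2 P (x - xs) + wnorm2 Q (y - ys)
     - (wnorm2 P (x - xb) + 2 * dot (xb - xs) (a - s))
     - (wnorm2 P (xb - x') + wnorm2 Q (y' - y)
        - 2 * dot (xb - x') (B^T *m (y' - y))).
Proof.
move=> PT QT [fb sb] [f' s'] [fs ss] hQ hB.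
have := s' xs; have := sb x'; have := ss xb.
rewrite -(fineK fb) -(fineK f') -(fineK fs) -!EFinD !lee_fin.
have e1 := three_point x x' xs PT.
have e2 := three_point x xb x' PT.
have e3 : 2 * dot (Q *m (y' - y)) (y' - ys)
    = wnorm2 Q (y' - y) + wnorm2 Q (y' - ys) - wnorm2 Q (y - ys).
  rewrite -(opprB y y') -(opprB ys y') mulmxN dotNl dotNr opprK !wnorm2N.
  exact: three_point.
have eB : dot (Q *m (y' - y)) (y' - ys) = dot (xb - xs) (B^T *m (y' - ys)).
  by rewrite hQ dot_mulmx trmxK mulmxBr hB subr0.
rewrite eB in e3.
rewrite (wnorm2_subC P x' xs) (wnorm2_subC P xb x').
move: e1 e2 e3.
move: (wnorm2 P (x - xs)) (wnorm2 P (x - xb)) (wnorm2 P (x - x')) => w1 w2 w3.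
rewrite !mulmxBr !dot_lin !(dotC (B^T *m _)) !(dotC (P *m _)) !(dotC a) !(dotC s).
lra.
Qed.

End SubgradientInequalities.

(** * Block vectors and lifted matrices *)

Section Blocks.
Context {R : realType}.

Lemma dot_usubmx_dsubmx {N1 N2} (u v : 'cV[R]_(N1 + N2)) :
  dot u v = dot (usubmx u) (usubmx v) + dot (dsubmx u) (dsubmx v).
Proof. by rewrite /dot -{1}(vsubmxK u) -{1}(vsubmxK v) tr_col_mx mul_row_col mxE. Qed.

Lemma dot_submxcol {m n} (u v : 'cV[R]_(lift_dim m n)) :
  dot u v = \sum_i dot (submxcol u i) (submxcol v i).
Proof.
rewrite /dot -{1}(submxcolK u) -{1}(submxcolK v) tr_mxcol mul_mxrow_mxcol.
by rewrite summxE.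
Qed.

Lemma submxcolZ {m n} a (u : 'cV[R]_(lift_dim m n)) i :
  submxcol (a *: u) i = a *: submxcol u i.
Proof. by apply/matrixP => r c; rewrite !mxE. Qed.

Lemma usubmxD {N1 N2} (u v : 'cV[R]_(N1 + N2)) :
  usubmx (u + v) = usubmx u + usubmx v.
Proof. by apply/matrixP => r c; rewrite !mxE. Qed.

Lemma usubmxZ {N1 N2} a (u : 'cV[R]_(N1 + N2)) :
  usubmx (a *: u) = a *: usubmx u.
Proof. by apply/matrixP => r c; rewrite !mxE. Qed.

Lemma usubmxN {N1 N2} (u : 'cV[R]_(N1 + N2)) : usubmx (- u) = - usubmx u.
Proof. by rewrite -scaleN1r usubmxZ scaleN1r. Qed.

Lemma dsubmxD {N1 N2} (u v : 'cV[R]_(N1 + N2)) :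
  dsubmx (u + v) = dsubmx u + dsubmx v.
Proof. by apply/matrixP => r c; rewrite !mxE. Qed.

Lemma dsubmxZ {N1 N2} a (u : 'cV[R]_(N1 + N2)) :
  dsubmx (a *: u) = a *: dsubmx u.
Proof. by apply/matrixP => r c; rewrite !mxE. Qed.

Lemma dsubmxN {N1 N2} (u : 'cV[R]_(N1 + N2)) : dsubmx (- u) = - dsubmx u.
Proof. by rewrite -scaleN1r dsubmxZ scaleN1r. Qed.

Lemma cvg_usubmx {T : Type} {F : set_system T} {FF : Filter F} {N1 N2}
    (x : T -> 'cV[R]_(N1 + N2)) (a : 'cV[R]_(N1 + N2)) :
  x @ F --> a -> (fun k => usubmx (x k)) @ F --> usubmx a.
Proof.
move=> /cvg_colP xa; apply/cvg_colP => r; rewrite mxE.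
by under eq_fun do rewrite mxE; exact: xa.
Qed.

Lemma cvg_dsubmx {T : Type} {F : set_system T} {FF : Filter F} {N1 N2}
    (x : T -> 'cV[R]_(N1 + N2)) (a : 'cV[R]_(N1 + N2)) :
  x @ F --> a -> (fun k => dsubmx (x k)) @ F --> dsubmx a.
Proof.
move=> /cvg_colP xa; apply/cvg_colP => r; rewrite mxE.
by under eq_fun do rewrite mxE; exact: xa.
Qed.

Lemma cvg_submxcol {T : Type} {F : set_system T} {FF : Filter F} {m n}
    (x : T -> 'cV[R]_(lift_dim m n)) (a : 'cV[R]_(lift_dim m n)) i :
  x @ F --> a -> (fun k => submxcol (x k) i) @ F --> submxcol a i.
Proof.
move=> /cvg_colP xa; apply/cvg_colP => r; rewrite mxE.
by under eq_fun do rewrite mxE; exact: xa.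
Qed.

(** The Kronecker product of [A] with the identity of size [n], in the block
    layout of stacked vectors. *)
Definition liftmx {m} n (A : 'M[R]_m) : 'M[R]_(lift_dim m n) :=
  \mxblock_(i < m, j < m) ((A i j)%:M : 'M[R]_n).

Lemma tr_liftmx {m n} (A : 'M[R]_m) : (liftmx n A)^T = liftmx n A^T.
Proof.
by rewrite tr_mxblock; apply: eq_mxblock => i j; rewrite tr_scalar_mx mxE.
Qed.

Lemma liftmxM {m n} (A B : 'M[R]_m) : liftmx n A *m liftmx n B = liftmx n (A *m B).
Proof.
rewrite mul_mxblock; apply: eq_mxblock => i j; rewrite mxE raddf_sum.
by apply: eq_bigr => k _; rewrite -scalar_mxM.
Qed.

Lemma liftmxZ {m n} a (A : 'M[R]_m) : liftmx n (a *: A) = a *: liftmx n A.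
Proof. by apply/matrixP => r c; rewrite !mxE mulrnAr. Qed.

Lemma submxcol_liftmx {m n} (A : 'M[R]_m) (x : 'cV[R]_(lift_dim m n)) i :
  submxcol (liftmx n A *m x) i = \sum_j A i j *: submxcol x j.
Proof.
rewrite -{1}(submxcolK x) mul_mxblock_mxrow mxcolK.
by apply: eq_bigr => j _; rewrite mul_scalar_mx.
Qed.

(** Lifted matrices act on each slice separately, which reduces quadratic forms
    of [liftmx n A] to those of [A]. *)
Definition slice {m n} (x : 'cV[R]_(lift_dim m n)) (c : 'I_n) : 'cV[R]_m :=
  \col_i submxcol x i c 0.

Lemma dot_slice {m n} (x y : 'cV[R]_(lift_dim m n)) :
  dot x y = \sum_c dot (slice x c) (slice y c).
Proof.
rewrite dot_submxcol; under eq_bigr do rewrite dotE.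
rewrite exchange_big; apply: eq_bigr => c _; rewrite dotE.
by apply: eq_bigr => i _; rewrite !mxE.
Qed.

Lemma slice_liftmx {m n} (A : 'M[R]_m) (x : 'cV[R]_(lift_dim m n)) c :
  slice (liftmx n A *m x) c = A *m slice x c.
Proof.
apply/colP => i; rewrite mxE submxcol_liftmx summxE mxE.
by apply: eq_bigr => j _; rewrite !mxE.
Qed.

Lemma psdmx_liftmx {m n} (S : 'M[R]_m) : psdmx S -> psdmx (liftmx n S).
Proof.
move=> [ST S0]; split=> [|z]; first by rewrite tr_liftmx ST.
by rewrite dot_slice sumr_ge0 // => c _; rewrite slice_liftmx.
Qed.

(** For symmetric [S], [dot (S *m x) (S *m x)] is [dot x (S *m S *m x)]. *)
Lemma psdmx_ker_sqr {N} (S : 'M[R]_N) (x : 'cV[R]_N) :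
  psdmx S -> S *m x = 0 <-> S *m S *m x = 0.
Proof.
move=> [ST _]; split=> [Sx|SSx]; first by rewrite -mulmxA Sx mulmx0.
by apply: dot_eq0; rewrite dot_mulmx ST mulmxA SSx dot0l.
Qed.

(** * Square roots and spectral bounds from entrywise nonnegativity *)

Section NonnegativeMatrix.
Context {m : nat} (A : 'M[R]_m).
Hypotheses (A_sym : A^T = A) (A_ge0 : forall i j, 0 <= A i j).

Let AC i j : A i j = A j i. Proof. by rewrite -{1}A_sym mxE. Qed.

Lemma dot_mulmx_entries (z : 'cV[R]_m) :
  dot z (A *m z) = \sum_i \sum_j A i j * (z i 0 * z j 0).
Proof.
rewrite dotE; apply: eq_bigr => i _; rewrite mxE mulr_sumr.
by apply: eq_bigr => j _; rewrite mulrCA.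
Qed.

Lemma sum_rows_sqr (z : 'cV[R]_m) :
  \sum_i \sum_j A i j * (z i 0 ^+ 2 + z j 0 ^+ 2)
  = 2 * \sum_i (\sum_j A i j) * z i 0 ^+ 2.
Proof.
under eq_bigr do under eq_bigr do rewrite mulrDr.
under eq_bigr do rewrite big_split /=.
rewrite big_split /= [X in _ + X]exchange_big /= mulr_natl mulr2n.
congr (_ + _); apply: eq_bigr => i _; rewrite mulr_suml //.
by apply: eq_bigr => j _; rewrite AC.
Qed.

(** Diagonal dominance, from [2 a b <= a ^ 2 + b ^ 2]. *)
Lemma psdmx_1sub : (forall i, \sum_j A i j <= 1) -> psdmx (1%:M - A).
Proof.
move=> A1; split=> [|z]; first by rewrite linearB /= trmx1 A_sym.
rewrite mulmxBl mul1mx dotDr dotNr subr_ge0 dot_mulmx_entries.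
have h1 : 2 * \sum_i \sum_j A i j * (z i 0 * z j 0)
    <= \sum_i \sum_j A i j * (z i 0 ^+ 2 + z j 0 ^+ 2).
  rewrite mulr_sumr ler_sum // => i _; rewrite mulr_sumr ler_sum // => j _.
  have := A_ge0 i j; have := sqr_ge0 (z i 0 - z j 0); nra.
have h2 : \sum_i (\sum_j A i j) * z i 0 ^+ 2 <= dot z z.
  by rewrite dotE ler_sum // => i _; rewrite -expr2 ler_piMl ?sqr_ge0.
by rewrite sum_rows_sqr in h1; lra.
Qed.

(** Of the sum of the [A i j * (z i + z j) ^ 2] keep only the diagonal. *)
Lemma diag_lower_bound (z : 'cV[R]_m) : (forall i, \sum_j A i j = 1) ->
  2 * \sum_i A i i * z i 0 ^+ 2 <= dot z z + dot z (A *m z).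
Proof.
move=> A1.
have h1 : 4 * \sum_i A i i * z i 0 ^+ 2
    <= \sum_i \sum_j A i j * (z i 0 ^+ 2 + z j 0 ^+ 2)
       + 2 * \sum_i \sum_j A i j * (z i 0 * z j 0).
  rewrite !mulr_sumr -big_split /= ler_sum // => i _.
  rewrite mulr_sumr -big_split /= (bigD1 i) //=.
  have : 0 <= \sum_(j < m | j != i)
     (A i j * (z i 0 ^+ 2 + z j 0 ^+ 2) + 2 * (A i j * (z i 0 * z j 0))).
    rewrite sumr_ge0 // => j _.
    have := A_ge0 i j; have := sqr_ge0 (z i 0 + z j 0); nra.
  lra.
rewrite sum_rows_sqr -dot_mulmx_entries in h1.
have h2 : \sum_i (\sum_j A i j) * z i 0 ^+ 2 = dot z z.
  by rewrite dotE; apply: eq_bigr => i _; rewrite A1 mul1r expr2.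
lra.
Qed.

End NonnegativeMatrix.

Section SquareRoot.
Context {m : nat} (A : 'M[R]_m).
Hypotheses (A_sym : A^T = A) (A_ge0 : forall i j, 0 <= A i j).

(** A fixed point [Y] of this iteration satisfies [2 Y = A + Y ^ 2], that is,
    [(1 - Y) ^ 2 = 1 - A].  Starting from 0 the iterates increase entrywise and
    keep row sums at most 1, so they converge. *)
Fixpoint sqrt_iter (k : nat) : 'M[R]_m :=
  if k is k'.+1 then 2^-1 *: (A + sqrt_iter k' *m sqrt_iter k') else 0.

Lemma sqrt_iter_sym k : (sqrt_iter k)^T = sqrt_iter k.
Proof.
by elim: k => [|k IH] /=; rewrite ?trmx0 // linearZ linearD /= trmx_mul IH A_sym.
Qed.

Lemma sqrt_iter_ge0 k i j : 0 <= sqrt_iter k i j.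
Proof.
elim: k i j => [|k IH] i j /=; rewrite !mxE // mulr_ge0 // addr_ge0 //.
by rewrite sumr_ge0 // => r _; rewrite mulr_ge0.
Qed.

Lemma sqrt_iter_le k i j : sqrt_iter k i j <= sqrt_iter k.+1 i j.
Proof.
elim: k i j => [|k IH] i j; first by rewrite mxE sqrt_iter_ge0.
rewrite [leLHS]mxE [leRHS]mxE ler_pM2l // [leLHS]mxE [leRHS]mxE lerD2l.
rewrite [leLHS]mxE [leRHS]mxE ler_sum // => r _.
by rewrite ler_pM // sqrt_iter_ge0.
Qed.

Hypothesis A_row : forall i, \sum_j A i j <= 1.

Lemma sqrt_iter_row k i : \sum_j sqrt_iter k i j <= 1.
Proof.
elim: k i => [|k IH] i /=.
  by rewrite big1 // => j _; rewrite mxE.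
under eq_bigr do rewrite !mxE.
rewrite -mulr_sumr big_split /= exchange_big /=.
under [X in _ + X]eq_bigr do rewrite -mulr_sumr.
have : \sum_r sqrt_iter k i r * \sum_j sqrt_iter k r j <= 1.
  apply: le_trans (IH i); rewrite ler_sum // => r _.
  by rewrite ler_piMr ?sqrt_iter_ge0.
have := A_row i; lra.
Qed.

(** The limit [Y] inherits symmetry, nonnegative entries and row sums at most 1,
    so [1 - Y] is positive semidefinite by diagonal dominance. *)
Lemma psdmx_sqrt_1sub : exists S : 'M[R]_m, psdmx S /\ S *m S = 1%:M - A.
Proof.
have Ycvg i j : cvgn (fun k => sqrt_iter k i j).
  apply: nondecreasing_is_cvgn.
    by apply/nondecreasing_seqP => k; exact: sqrt_iter_le.
  exists 1 => _ [k _ <-]; apply: le_trans (sqrt_iter_row k i).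
  by rewrite (bigD1 j) //= lerDl sumr_ge0 // => r _; exact: sqrt_iter_ge0.
pose Y : 'M[R]_m := \matrix_(i, j) limn (fun k => sqrt_iter k i j).
have YC i j : (fun k => sqrt_iter k i j) @ \oo --> Y i j.
  by rewrite mxE; exact: Ycvg.
have YT : Y^T = Y.
  apply/matrixP => i j; rewrite !mxE; congr (limn _); apply/funext => k.
  by rewrite -{1}sqrt_iter_sym mxE.
have Y0 i j : 0 <= Y i j.
  by apply: cvgr_to_ge (YC i j) _; apply: nearW => k; exact: sqrt_iter_ge0.
have Y1 i : \sum_j Y i j <= 1.
  apply: cvgr_to_le (cvg_fsum (fun j => YC i j)) _.
  by apply: nearW => k; exact: sqrt_iter_row.
have YE : 2 *: Y = A + Y *m Y.
  suff YE : Y = 2^-1 *: (A + Y *m Y).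
    by rewrite {1}YE scalerA mulfV ?scale1r // pnatr_eq0.
  apply/matrixP => i j.
  apply: (@cvg_unique _ (@Rhausdorff R) ((fun k => sqrt_iter k.+1 i j) @ \oo)).
    by have := YC i j; rewrite -cvg_shiftS.
  have -> : (2^-1 *: (A + Y *m Y)) i j = 2^-1 * (A i j + \sum_r Y i r * Y r j).
    by rewrite mxE; congr (_ * _); rewrite mxE; congr (_ + _); rewrite mxE.
  have -> : (fun k => sqrt_iter k.+1 i j) = fun k =>
      2^-1 * (A i j + \sum_r sqrt_iter k i r * sqrt_iter k r j).
    by apply/funext => k; rewrite !mxE.
  apply: cvgM; first exact: cvg_cst.
  apply: cvgD; first exact: cvg_cst.
  by apply: cvg_fsum => r; apply: cvgM.
exists (1%:M - Y); split; first exact: psdmx_1sub.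
have -> : A = Y + Y - Y *m Y by rewrite -mulr2n -scaler_nat YE addrK.
by rewrite mulmxBl mul1mx mulmxBr mulmx1 !opprD !opprK !addrA.
Qed.

End SquareRoot.

End Blocks.

(** * The matrices of the iteration *)

Section Matrices.
Context {R : realType} {m : nat}.
Implicit Types (t : 'I_m -> R) (W : 'M[R]_m).

Lemma Gamma1E {n} t : Gamma1 t = liftmx n (diag_mx (\row_i t i)).
Proof.
apply: eq_mxblock => i j; rewrite !mxE; case: eqVneq => [->|ij] /=.
  by rewrite mulr1n conform_mx_id.
by rewrite raddf0.
Qed.

Lemma Gamma2E {p} t : Gamma2 t = Gamma1 t :> 'M[R]_(lift_dim m p).
Proof. by []. Qed.

Lemma submxcol_Gamma1 {n} t (x : 'cV[R]_(lift_dim m n)) i :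
  submxcol (Gamma1 t *m x) i = t i *: submxcol x i.
Proof.
rewrite Gamma1E submxcol_liftmx (bigD1 i) //= big1 ?addr0 ?mxE ?eqxx //.
by move=> j ji; rewrite !mxE eq_sym (negPf ji) scale0r.
Qed.

Lemma tr_Gamma1 {n} t : (Gamma1 t)^T = Gamma1 t :> 'M[R]_(lift_dim m n).
Proof. by rewrite Gamma1E tr_liftmx tr_diag_mx. Qed.

Lemma wnorm2_Gamma1 {n} t (x : 'cV[R]_(lift_dim m n)) :
  wnorm2 (Gamma1 t) x = \sum_i t i * dot (submxcol x i) (submxcol x i).
Proof.
rewrite /wnorm2 dot_submxcol; apply: eq_bigr => i _.
by rewrite submxcol_Gamma1 dotZr.
Qed.

Lemma eq_submxcol {n} (x y : 'cV[R]_(lift_dim m n)) :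
  (forall i, submxcol x i = submxcol y i) -> x = y.
Proof. by move=> xy; rewrite -(submxcolK x) -(submxcolK y); apply: eq_mxcol. Qed.

Lemma Gamma1M {n} t t' :
  Gamma1 t *m Gamma1 t' = Gamma1 (fun i => t i * t' i) :> 'M[R]_(lift_dim m n).
Proof.
rewrite !Gamma1E liftmxM mulmx_diag; congr (liftmx n (diag_mx _)).
by apply/rowP => i; rewrite !mxE.
Qed.

Lemma Gamma1_1 {n} : Gamma1 (fun=> 1) = 1%:M :> 'M[R]_(lift_dim m n).
Proof. exact: mxdiagZ. Qed.

Lemma tr_Gamma {n p} t : (Gamma t)^T = Gamma t :> 'M[R]_(full_dim m n p).
Proof. by rewrite tr_block_mx !Gamma2E !tr_Gamma1 !trmx0. Qed.

Lemma wnorm2_Gamma {n p} t (x : 'cV[R]_(full_dim m n p)) :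
  wnorm2 (Gamma t) x
  = wnorm2 (Gamma1 t) (usubmx x) + wnorm2 (Gamma1 t) (dsubmx x).
Proof.
rewrite /wnorm2 -{1 2}(vsubmxK x) mul_block_col !mul0mx addr0 add0r.
by rewrite dot_usubmx_dsubmx !col_mxKu !col_mxKd.
Qed.

Lemma mulGammaV {n p} t : (forall i, 0 < t i) ->
  Gamma (fun i => (t i)^-1) *m Gamma t = 1%:M :> 'M[R]_(full_dim m n p).
Proof.
move=> t0; have tV : (fun i => (t i)^-1 * t i) = fun=> 1.
  by apply/funext => i; rewrite mulVf ?gt_eqF.
rewrite mulmx_block !mul0mx !mulmx0 !add0r !addr0 !Gamma2E !Gamma1M tV !Gamma1_1.
by rewrite scalar_mx_block.
Qed.

Lemma invmx_Gamma {n p} t : (forall i, 0 < t i) ->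
  invmx (Gamma t) = Gamma (fun i => (t i)^-1) :> 'M[R]_(full_dim m n p).
Proof.
move=> t0; have G1 := @mulGammaV n p t t0.
have [_ Gu] := mulmx1_unit G1.
by rewrite -[RHS]mulmx1 -(mulmxV Gu) mulmxA G1 mul1mx.
Qed.

Section Mixing.
Context {e : rel 'I_m} {W : 'M[R]_m} (Wmix : mixing_matrix e W).

Lemma VmxE {n} : Vmx W = liftmx n (2^-1 *: (1%:M - W)).
Proof. by rewrite liftmxZ. Qed.

(** [V] is [1 - (1 + W) / 2], and [(1 + W) / 2] is nonnegative and stochastic. *)
Lemma sqrtmx_VmxP {n} :
  psdmx (sqrtmx (Vmx W) : 'M[R]_(lift_dim m n)) /\
  sqrtmx (Vmx W) *m sqrtmx (Vmx W) = Vmx W :> 'M[R]_(lift_dim m n).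
Proof.
have [S [S0 SS]] : exists S, psdmx S /\ S *m S = 1%:M - 2^-1 *: (1%:M + W).
  apply: psdmx_sqrt_1sub => [|i j|i].
  - by rewrite linearZ linearD /= trmx1 (mix_sym Wmix).
  - by rewrite !mxE mulr_ge0 // addr_ge0 ?(mix_ge0 Wmix).
  - under eq_bigr do rewrite !mxE; rewrite -mulr_sumr big_split /= (mix_row Wmix).
    rewrite (bigD1 i) //= eqxx big1 ?addr0; first by rewrite mulVf // pnatr_eq0.
    by move=> j; rewrite eq_sym => /negPf ->.
apply: (@xgetPex _ 0 [set S | psdmx S /\ S *m S = Vmx W]).
exists (liftmx n S); split; first exact: psdmx_liftmx.
rewrite liftmxM SS VmxE; congr (liftmx n _).
rewrite -[X in X - _]scale1r -{1}(mulVf (_ : 2 != 0 :> R)) ?pnatr_eq0 //.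
rewrite -scalerA -scalerBr scaler_nat mulr2n; congr (_ *: _).
by rewrite opprD addrA addrK.
Qed.

(** A quantitative form of [W > -1]: the diagonal of [W] is positive. *)
Lemma Vmx_gap {n} (x : 'cV[R]_(lift_dim m n)) :
  \sum_i W i i * dot (submxcol x i) (submxcol x i) <= dot x x - dot x (Vmx W *m x).
Proof.
have -> : \sum_i W i i * dot (submxcol x i) (submxcol x i)
    = \sum_c \sum_i W i i * slice x c i 0 ^+ 2.
  rewrite exchange_big /=; apply: eq_bigr => i _; rewrite dotE mulr_sumr.
  by apply: eq_bigr => c _; rewrite !mxE expr2.
rewrite !dot_slice -sumrB ler_sum // => c _; rewrite VmxE slice_liftmx.
have := diag_lower_bound (mix_sym Wmix) (mix_ge0 Wmix) (slice x c) (mix_row Wmix).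
rewrite -scalemxAl mulmxBl mul1mx !dot_lin; lra.
Qed.

(** [sqrt V] has the kernel of [V], and slice by slice this is the kernel of
    [1 - W], which consists of the constant vectors. *)
Lemma sqrtmx_Vmx_consensus {n} (x : 'cV[R]_(lift_dim m n)) :
  sqrtmx (Vmx W) *m x = 0 <-> forall i j, submxcol x i = submxcol x j.
Proof.
have [Spsd SS] := @sqrtmx_VmxP n.
have VxE i : submxcol (Vmx W *m x) i = 2^-1 *: (submxcol x i - \sum_j W i j *: submxcol x j).
  rewrite VmxE liftmxZ -scalemxAl submxcolZ submxcol_liftmx; congr (_ *: _).
  under eq_bigr do rewrite !mxE scalerBl; rewrite sumrB; congr (_ - _).
  rewrite (bigD1 i) //= eqxx scale1r big1 ?addr0 // => j.
  by rewrite eq_sym => /negPf ->; rewrite scale0r.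
rewrite psdmx_ker_sqr // SS; split=> [Vx i j|xc].
  apply/colP => c.
  have : [set v : 'cV[R]_m | (1%:M - W) *m v = 0] (slice x c).
    rewrite /=; have : slice (Vmx W *m x) c = 0.
      by rewrite Vx; apply/colP => k; rewrite !mxE.
    rewrite VmxE slice_liftmx -scalemxAl => /eqP.
    by rewrite scaler_eq0 invr_eq0 pnatr_eq0 /= => /eqP.
  rewrite (mix_null Wmix) => -[a _ ax].
  have xa k : submxcol x k c 0 = a.
    by have := congr1 (fun v : 'cV[R]_m => v k 0) ax; rewrite !mxE.
  by rewrite !xa.
apply: eq_submxcol => i; rewrite VxE submxcol0.
under eq_bigr do rewrite -(xc i); rewrite -scaler_suml (mix_row Wmix).
by rewrite scale1r subrr scaler0.
Qed.

Section StepSize.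
Context {n p : nat} {U : 'I_m -> 'M[R]_(p, n)} {tau : 'I_m -> R} {beta : R}.
Hypotheses (beta_gt0 : 0 < beta) (tau_beta : forall i, tau i * beta < 1).

Lemma le_tau_max i : tau i <= tau_max tau.
Proof. exact: le_bigmax. Qed.

Lemma tau_max_beta : tau_max tau * beta < 1.
Proof.
rewrite -ltr_pdivlMr // /tau_max bigmax_lt ?divr_gt0 // => i _.
by rewrite ltr_pdivlMr.
Qed.

Lemma tr_Qmx : (Qmx U tau beta)^T = Qmx U tau beta.
Proof.
rewrite /Qmx tr_block_mx tr_scalar_mx !trmx0 /Smx !linearD !linearZ /=.
by rewrite !trmx_mul !trmxK !Gamma2E !tr_Gamma1 !mulmxA.
Qed.

Lemma wnorm2_Qmx (d : 'cV[R]_(full_dim m n p)) :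
  wnorm2 (Qmx U tau beta) d
  = beta^-1 * dot (usubmx d) (usubmx d) + 2 * wnorm2 (Gamma1 tau) (dsubmx d)
    + wnorm2 (Gamma1 tau) ((Umx U)^T *m dsubmx d)
    + beta / (1 - tau_max tau * beta)
      * dot (Gamma1 tau *m ((Umx U)^T *m dsubmx d))
            (Gamma1 tau *m ((Umx U)^T *m dsubmx d)).
Proof.
rewrite /wnorm2 -{1 2}(vsubmxK d) mul_block_col !mul0mx addr0 add0r.
rewrite dot_usubmx_dsubmx !col_mxKu !col_mxKd mul_scalar_mx dotZr.
rewrite /Smx !mulmxDl -!scalemxAl !dot_lin Gamma2E -!mulmxA !(dot_mulmx (Umx U)).
by rewrite (dot_mulmx (Gamma1 tau) _ (Gamma1 tau *m _)) tr_Gamma1 !addrA.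
Qed.

Lemma trBmx_mul (d : 'cV[R]_(full_dim m n p)) :
  (Bmx W U)^T *m d
  = col_mx (sqrtmx (Vmx W) *m usubmx d + (Umx U)^T *m dsubmx d) (- dsubmx d).
Proof.
have [[ST _] _] := @sqrtmx_VmxP n.
rewrite -{1}(vsubmxK d) tr_block_mx mul_block_col ST trmx0 mul0mx add0r.
by rewrite linearN /= trmx1 mulNmx mul1mx.
Qed.

(** [Q] dominates [B Gamma B^T]: the only cross term couples [sqrt V d1] with
    [Gamma1 U^T d2], and Young's inequality with the weight [1 / beta - tau]
    on the first factor puts exactly the third summand of [S] on the second.
    The surplus controls both components of [d]. *)
Lemma Qmx_dominates (d : 'cV[R]_(full_dim m n p)) :
  wnorm2 (Gamma tau) ((Bmx W U)^T *m d)
  + \sum_i (beta^-1 * W i i) * dot (submxcol (usubmx d) i) (submxcol (usubmx d) i)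
  + \sum_i tau i * dot (submxcol (dsubmx d) i) (submxcol (dsubmx d) i)
  <= wnorm2 (Qmx U tau beta) d.
Proof.
have [[ST _] SS] := @sqrtmx_VmxP n.
rewrite trBmx_mul wnorm2_Gamma col_mxKu col_mxKd wnorm2_Qmx wnorm2N.
set q := (Umx U)^T *m dsubmx d; set s := sqrtmx (Vmx W) *m usubmx d.
rewrite -wnorm2_Gamma1 wnorm2D ?tr_Gamma1 //.
have gap : \sum_i (beta^-1 * W i i) * dot (submxcol (usubmx d) i) (submxcol (usubmx d) i)
    <= beta^-1 * (dot (usubmx d) (usubmx d) - dot s s).
  under eq_bigr do rewrite -mulrA.
  rewrite -mulr_sumr ler_pM2l ?invr_gt0 //; apply: le_trans (Vmx_gap _) _.
  by rewrite -SS -mulmxA dot_mulmx ST.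
have s_tau : wnorm2 (Gamma1 tau) s <= tau_max tau * dot s s.
  rewrite wnorm2_Gamma1 dot_submxcol mulr_sumr ler_sum // => i _.
  by rewrite ler_wpM2r ?dot_ge0 ?le_tau_max.
set g := beta / (1 - tau_max tau * beta).
have den : 0 < 1 - tau_max tau * beta by rewrite subr_gt0 tau_max_beta.
have g0 : 0 < g by rewrite divr_gt0.
have gV : g^-1 = beta^-1 - tau_max tau.
  by rewrite /g; field; rewrite !gt_eqF //.
have young : 2 * dot s (Gamma1 tau *m q)
    <= g^-1 * dot s s + g * dot (Gamma1 tau *m q) (Gamma1 tau *m q).
  have := dot_ge0 (s - g *: (Gamma1 tau *m q)).
  rewrite !dot_lin (dotC (Gamma1 tau *m q) s).
  move: (dot s s) (dot s _) (dot (Gamma1 tau *m q) _) => a b c h.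
  rewrite -(ler_pM2l g0) mulrDr mulVKf ?gt_eqF //; lra.
rewrite gV in young; lra.
Qed.

End StepSize.

End Mixing.

End Matrices.

(** * The separable objective *)

Section Objective.
Context {R : realType} {m n p : nat}.
Context {f : 'I_m -> 'cV[R]_n -> R} {g : 'I_m -> 'cV[R]_p -> \bar R}.
Implicit Types x z u : 'cV[R]_(full_dim m n p).

Local Notation ub x i := (submxcol (usubmx x) i).
Local Notation lb x i := (submxcol (dsubmx x) i).

(* Stated on [R], so that rewriting cannot touch the sums in the dimensions. *)
Let sumD (a b : 'I_m -> R) : \sum_i a i + \sum_i b i = \sum_i (a i + b i).
Proof. by rewrite big_split. Qed.

Let blkD := (@usubmxD, @dsubmxD, @usubmxN, @dsubmxN, @usubmxZ, @dsubmxZ,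
  @submxcolD, @submxcolN, @submxcolZ).

Section Smooth.
Context {L : 'I_m -> R}.
Hypotheses (L_gt0 : forall i, 0 < L i) (f_convex : forall i, convex_function setT (f i))
  (f_diff : forall i v, differentiable (f i) v)
  (f_lip : forall i, lipschitz_gradient (L i) (f i)).

(** Along a line each block of [x] moves along a line, so the directional
    derivative splits over the blocks. *)
Lemma derive_Fsum x u :
  'D_u (Fsum f) x = \sum_i dot (gradient (f i) (ub x i)) (ub u i).
Proof.
have -> : Fsum f = \sum_i (fun x : 'cV[R]_(full_dim m n p) => f i (ub x i)).
  by apply/funext => y; rewrite fct_sumE.
have fi i : is_derive x u (fun x : 'cV[R]_(full_dim m n p) => f i (ub x i))
                    (dot (gradient (f i) (ub x i)) (ub u i)).
  have E : (fun h : R => h^-1 *: (((fun x : 'cV[R]_(full_dim m n p) => f i (ub x i))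
               \o shift x) (h *: u) - f i (ub x i)))
         = fun h => h^-1 *: ((f i \o shift (ub x i)) (h *: (ub u i)) - f i (ub x i)).
    by apply/funext => h /=; rewrite !blkD.
  apply: DeriveDef; first by rewrite /derivable E; exact: diff_derivable.
  by rewrite /derive E -derive_gradient.
exact: derive_val.
Qed.

Lemma dot_gradient_Fsum x u :
  dot (gradient (Fsum f) x) u = \sum_i dot (gradient (f i) (ub x i)) (ub u i).
Proof.
rewrite dotE; under eq_bigr do rewrite mxE derive_Fsum mulr_suml.
rewrite exchange_big; apply: eq_bigr => i _.
have uE : (ub u i) = \sum_r u r 0 *: ub (delta_mx r 0 : 'cV[R]_(full_dim m n p)) i.
  rewrite {1}[u]col_sum_delta; apply/colP => c; rewrite !mxE !summxE.
  by apply: eq_bigr => r _; rewrite !mxE.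
rewrite uE dot_sumr; apply: eq_bigr => r _; rewrite dotZr mulrC; congr (_ * _).
Qed.

Lemma Fsum_gradient_le x z : Fsum f x + dot (gradient (Fsum f) x) (z - x) <= Fsum f z.
Proof.
rewrite dot_gradient_Fsum /Fsum !sumD ler_sum // => i _.
by rewrite !blkD; exact: convex_gradient_le.
Qed.

Lemma Fsum_descent x u :
  Fsum f (x + u) <= Fsum f x + dot (gradient (Fsum f) x) u
                    + \sum_i L i / 2 * dot (ub u i) (ub u i).
Proof.
rewrite dot_gradient_Fsum /Fsum !sumD ler_sum // => i _.
by rewrite !blkD addrC; exact: descent_lemma.
Qed.

(** Cocoercivity absorbs the error made by evaluating the gradient at [x]
    rather than at [xb], leaving [L i / 2] times the squared distance. *)
Lemma Fsum_forward_error x xb z :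
  - \sum_i L i / 2 * dot (ub (x - xb) i) (ub (x - xb) i)
  <= 2 * dot (xb - z) (gradient (Fsum f) x - gradient (Fsum f) z).
Proof.
have -> : dot (xb - z) (gradient (Fsum f) x - gradient (Fsum f) z)
    = \sum_i dot (gradient (f i) (ub x i) - gradient (f i) (ub z i)) (ub (xb - z) i).
  rewrite dotC dotDl dotNl !dot_gradient_Fsum -sumrB.
  by apply: eq_bigr => i _; rewrite dotDl dotNl.
rewrite mulr_sumr -sumrN ler_sum // => i _; rewrite !blkD.
have := @cocoercive _ _ (L i) (f i) (ub x i) (ub z i)
  (L_gt0 i) (f_convex i) (f_diff i) (f_lip i).
set d := gradient _ _ - _; set b := ub x i; set c := ub xb i; set a := ub z i.
have -> : c - a = (b - a) - (b - c) by rewrite opprB [RHS]addrC addrA subrK.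
move: (b - a) (b - c) => v w; have := dot_ge0 (d - (L i / 2) *: w).
clearbody d; rewrite !dot_lin (dotC w d).
move: (dot d d) (dot d v) (dot d w) (dot w w) => D dv dw ww h1 h2.
suff : 0 <= L i * (2 * (dv - dw) + L i / 2 * ww) by rewrite pmulr_rge0 //; lra.
lra.
Qed.


Lemma cvg_gradient_Fsum {T : Type} {F : set_system T} {FF : Filter F}
    (x : T -> 'cV[R]_(full_dim m n p)) (a : 'cV[R]_(full_dim m n p)) :
  x @ F --> a -> (fun k => gradient (Fsum f) (x k)) @ F --> gradient (Fsum f) a.
Proof.
move=> xa.
have ga i : (fun k => gradient (f i) (ub (x k) i)) @ F --> gradient (f i) (ub a i).
  have xai : (fun k => ub (x k) i) @ F --> ub a i.
    exact: cvg_submxcol (cvg_usubmx xa).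
  apply: (cvg_of_sqr_dist (e := fun k =>
      L i ^+ 2 * dot (ub (x k) i - ub a i) (ub (x k) i - ub a i))).
    by move=> k; exact: lipschitz_sqr.
  have d0 : (fun k => ub (x k) i - ub a i) @ F --> (0 : 'cV[R]_n).
    by rewrite -(subrr (ub a i)); apply: cvgB => //; exact: cvg_cst.
  rewrite -(mulr0 (L i ^+ 2)) -(dot0l (0 : 'cV[R]_n)).
  by apply: cvgM; [exact: cvg_cst|exact: cvg_dot].
apply/cvg_colP => r; rewrite mxE derive_Fsum.
under eq_fun do rewrite mxE derive_Fsum.
by apply: cvg_fsum => i; apply: cvg_dot => //; exact: cvg_cst.
Qed.

End Smooth.

Section Nonsmooth.
Hypothesis g_cpc : forall i, convex_proper_closed (g i).

Lemma Gsum_gt_ninfty x : (-oo < Gsum g x)%E.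
Proof.
rewrite ltNye esum_eqNy negb_exists; apply/forallP => i.
by rewrite -ltNye (cpc_gt_ninfty (g_cpc i)).
Qed.

(** No summand is [-oo], so sums of extended reals distribute and split. *)
Lemma Gsum_convex (t : R) (x z : 'cV[R]_(full_dim m n p)) : 0 < t < 1 ->
  (Gsum g (t *: x + (1 - t) *: z)%R <= t%:E * Gsum g x + (1 - t)%:E * Gsum g z)%E.
Proof.
move=> t01; rewrite /Gsum.
have gdef (v w : 'I_m -> 'cV[R]_p) i j : (g i (v i) +? g j (w j))%E.
  have := cpc_gt_ninfty (g_cpc i) (v i); have := cpc_gt_ninfty (g_cpc j) (w j).
  by case: (g i (v i)) (g j (w j)) => [a||] [b||].
rewrite !fin_num_sume_distrr // -[leRHS]big_split lee_sum // => i _.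
by rewrite !blkD; exact: (cpc_convex (g_cpc i)).
Qed.

Lemma Gsum_proper : exists x : 'cV[R]_(full_dim m n p), (Gsum g x < +oo)%E.
Proof.
have /choice[v vP] := fun i => cpc_proper (g_cpc i).
exists (col_mx 0 (\mxcol_i v i)).
by rewrite /Gsum col_mxKd lte_sum_pinfty // => i _; rewrite mxcolK.
Qed.

(** Test vectors that differ from [x] in a single block isolate one summand;
    moving the first half of [x], on which [Gsum] does not depend, forces
    [usubmx u = 0]. *)
Lemma subgradient_GsumP x u :
  subgradient (Gsum g) x u <->
  usubmx u = 0 /\ forall i, subgradient (g i) (lb x i) (lb u i).
Proof.
have Gfin (y : 'cV[R]_(full_dim m n p)) :
    Gsum g y \is a fin_num <-> forall i, g i (lb y i) \is a fin_num.
  by split=> [/sum_fin_numP h i|h]; [|apply/sum_fin_numP => i _ _]; exact: h.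
split=> [[fx xu]|[u0 xu]].
  have fxi := (Gfin x).1 fx.
  split=> [|i].
    apply: dot_eq0; apply: le_anti; rewrite dot_ge0 andbT.
    have := xu (col_mx (usubmx x + usubmx u) (dsubmx x)).
    have -> : Gsum g (col_mx (usubmx x + usubmx u) (dsubmx x)) = Gsum g x.
      by rewrite /Gsum col_mxKd.
    rewrite -(fineK fx) -EFinD lee_fin gerDl.
    by rewrite dot_usubmx_dsubmx !blkD col_mxKu col_mxKd subrr dot0r addr0 addrAC subrr add0r.
  split=> // zi.
  pose z : 'cV[R]_(full_dim m n p) :=
    col_mx (usubmx x) (\mxcol_j (if j == i then zi else lb x j)).
  have zE j : lb z j = if j == i then zi else lb x j by rewrite col_mxKd mxcolK.
  have := xu z.
  have -> : dot u (z - x) = dot (lb u i) (zi - lb x i).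
    rewrite dot_usubmx_dsubmx !blkD col_mxKu subrr dot0r add0r dot_submxcol.
    rewrite (bigD1 i) //= [X in _ + X]big1 ?addr0; first by rewrite !blkD zE eqxx.
    by move=> j ji; rewrite !blkD zE (negPf ji) subrr dot0r.
  rewrite /Gsum (bigD1 i) //= [leRHS](bigD1 i) //= zE eqxx.
  have -> : (\sum_(j < m | j != i) g j (lb z j) = \sum_(j < m | j != i) g j (lb x j))%E.
    by apply: eq_bigr => j ji; rewrite zE (negPf ji).
  set r := (\sum_(j < m | j != i) _)%E.
  have fr : r \is a fin_num by apply/sum_fin_numP => j _ _; exact: fxi.
  by rewrite addeAC leeD2rE.
have fx := (Gfin x).2 (fun i => (xu i).1).
split=> // z.
have -> : dot u (z - x) = \sum_i dot (lb u i) (lb z i - lb x i).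
  rewrite dot_usubmx_dsubmx u0 dot0l add0r dot_submxcol.
  by apply: eq_bigr => i _; rewrite !blkD.
rewrite /Gsum -sumEFin -[leLHS]big_split lee_sum // => i _.
by have [_] := xu i; apply.
Qed.

Lemma subgradient_Gsum_limit {T : Type} {F : set_system T}
    (x u : T -> 'cV[R]_(full_dim m n p)) (a b : 'cV[R]_(full_dim m n p)) :
  ProperFilter F -> (forall k, subgradient (Gsum g) (x k) (u k)) ->
  x @ F --> a -> u @ F --> b -> subgradient (Gsum g) a b.
Proof.
move=> FP xu xa ub; apply/subgradient_GsumP; split=> [|i].
  have : (fun k => usubmx (u k)) @ F --> usubmx b by exact: cvg_usubmx.
  have -> : (fun k => usubmx (u k)) = fun=> 0.
    by apply/funext => k; have /subgradient_GsumP[] := xu k.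
  move=> c0; apply: (@cvg_unique _ (@norm_hausdorff _ _) _ _ _ _ c0 (cvg_cst 0)).
apply: (@subgradient_limit _ _ F _ _ (fun k => lb (x k) i) (fun k => lb (u k) i)) => //.
- by move=> k; have /subgradient_GsumP[] := xu k.
- exact: cvg_submxcol (cvg_dsubmx xa).
- exact: cvg_submxcol (cvg_dsubmx ub).
Qed.

End Nonsmooth.
End Objective.

(** * Saddle points and convergence *)

Section Convergence.
Context {R : realType} {m n p : nat}.
Context {e : rel 'I_m} {W : 'M[R]_m} {U : 'I_m -> 'M[R]_(p, n)}.
Context {f : 'I_m -> 'cV[R]_n -> R} {g : 'I_m -> 'cV[R]_p -> \bar R}.
Context {L tau : 'I_m -> R} {beta : R}.
Hypotheses (W_mixing : mixing_matrix e W) (L_gt0 : forall i, 0 < L i)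
  (f_convex : forall i, convex_function setT (f i))
  (f_diff : forall i v, differentiable (f i) v)
  (f_lip : forall i, lipschitz_gradient (L i) (f i))
  (g_cpc : forall i, convex_proper_closed (g i)).

Local Notation vec := 'cV[R]_(full_dim m n p).
Local Notation B := (Bmx W U).
Local Notation Q := (Qmx U tau beta).
Local Notation P := (Gamma (fun i => (tau i)^-1)).
Local Notation gradF := (gradient (Fsum f)).

Lemma lagrangianE (x y : vec) :
  lagrangian W U f g x y = (Gsum g x + (Fsum f x + dot y (B *m x))%:E)%E.
Proof. by rewrite /lagrangian EFinD addeA (addeC (Gsum g x)). Qed.

(** The Lagrangian is affine in [y], so a saddle point is exactly a feasible
    point satisfying the first-order condition in [x]. *)
Lemma saddle_pointsP (x y : vec) :
  saddle_points W U f g (x, y) <->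
  B *m x = 0 /\ subgradient (Gsum g) x (- gradF x - B^T *m y).
Proof.
split=> [sad|[Bx [fx xu]]].
  have xsub : subgradient (Gsum g) x (- gradF x - B^T *m y).
    rewrite -opprD.
    apply: (subgradient_of_argmin (phi := fun z => Fsum f z + dot y (B *m z))
        (q := fun d => \sum_i L i / 2 * dot (submxcol (usubmx d) i) (submxcol (usubmx d) i))).
    - exact: Gsum_gt_ninfty.
    - exact: Gsum_convex.
    - exact: Gsum_proper.
    - move=> t d _; have := Fsum_descent L_gt0 f_diff f_lip x (t *: d).
      rewrite mulmxDr -scalemxAr dotDr !dotZr (dotDl d) (dot_mulmx B y d).
      have -> : \sum_i L i / 2
            * dot (submxcol (usubmx (t *: d)) i) (submxcol (usubmx (t *: d)) i)
          = t ^+ 2 * \sum_i L i / 2 * dot (submxcol (usubmx d) i) (submxcol (usubmx d) i).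
        rewrite mulr_sumr; apply: eq_bigr => i _.
        by rewrite usubmxZ submxcolZ dotZl dotZr expr2; ring.
      lra.
    - by move=> z; rewrite -!lagrangianE; have [] := sad z y.
  split=> //; have [fx _] := xsub.
  have [+ _] := sad x (y + B *m x).
  rewrite !lagrangianE -(fineK fx) -!EFinD lee_fin /= dotDl => h.
  by apply: dot_eq0; apply: le_anti; rewrite dot_ge0 andbT; lra.
move=> z y'; rewrite !lagrangianE /= Bx !dot0r; split=> //.
have := xu z; have := Fsum_gradient_le f_convex f_diff x z.
have : dot y (B *m z) = dot (B^T *m y) (z - x).
  by rewrite -dot_mulmx mulmxBr Bx subr0.
rewrite (dotDl (z - x)) !dotNl -(fineK fx) -!EFinD.
case: (Gsum g z) (Gsum_gt_ninfty g_cpc z) => [c||]// _; last first.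
  by move=> *; rewrite addye // leey.
rewrite -!EFinD !lee_fin; lra.
Qed.

(** A feasible point of a saddle pair is in consensus and solves the original
    problem: compare it with the stacked vector of any candidate [v]. *)
Lemma saddle_point_solution (m_gt0 : (0 < m)%N) (x y : vec) :
  saddle_points W U f g (x, y) ->
  exists v : 'cV[R]_n, usubmx x = \mxcol_(i < m) v /\ argmin (primal_objective U f g) v.
Proof.
move=> sad; have [Bx _] := (saddle_pointsP x y).1 sad.
have UE (z : 'cV[R]_(lift_dim m n)) i : submxcol (Umx U *m z) i = U i *m submxcol z i.
  rewrite -{1}(submxcolK z) mul_mxblock_mxrow mxcolK (bigD1 i) //= eqxx.
  rewrite [X in _ + X]big1 ?addr0 // => j; rewrite eq_sym => /negPf ->.
  by rewrite mul0mx.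
have Bcol (a : 'cV[R]_(lift_dim m n)) (b : 'cV[R]_(lift_dim m p)) :
    B *m col_mx a b = col_mx (sqrtmx (Vmx W) *m a) (Umx U *m a - b).
  by rewrite mul_block_col mul0mx addr0 mulNmx mul1mx.
have obj (v : 'cV[R]_n) (z : vec) : usubmx z = \mxcol_(i < m) v ->
    dsubmx z = Umx U *m usubmx z -> primal_objective U f g v = ((Fsum f z)%:E + Gsum g z)%E.
  move=> zv zU; rewrite /primal_objective /Fsum /Gsum -sumEFin -[RHS]big_split.
  by apply: eq_bigr => i _; rewrite zU UE zv mxcolK.
move: (Bx); rewrite -{1}(vsubmxK x) Bcol -col_mx0 => /eq_col_mx[Sx Ux].
have xU : dsubmx x = Umx U *m usubmx x.
  by apply/esym/eqP; rewrite -subr_eq0 Ux.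
pose i0 := Ordinal m_gt0; pose v := submxcol (usubmx x) i0.
have xv : usubmx x = \mxcol_(i < m) v.
  by apply: eq_submxcol => i; rewrite mxcolK; move/(sqrtmx_Vmx_consensus W_mixing): Sx; apply.
exists v; split=> // w.
pose z : vec := col_mx (\mxcol_(i < m) w) (Umx U *m \mxcol_(i < m) w).
rewrite (obj v x xv xU) (obj w z) ?col_mxKu ?col_mxKd //.
have Bz : B *m z = 0.
  rewrite /z Bcol subrr (_ : sqrtmx _ *m _ = 0) ?col_mx0 //.
  by apply/(sqrtmx_Vmx_consensus W_mixing) => i j; rewrite !mxcolK.
have [_ +] := sad z y; rewrite /lagrangian /= Bz Bx.
by rewrite !dot0r !adde0.
Qed.

Hypotheses (beta_gt0 : 0 < beta) (tau_step : forall i, 0 < tau i < 2 / L i)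
  (tau_beta : forall i, 0 < tau i * beta < 1).
Context {x xbar y : nat -> vec}.
Hypothesis disa : DISA_sequence W U f g tau beta x xbar y.

Let tau_gt0 i : 0 < tau i. Proof. by have /andP[] := tau_step i. Qed.
Let tau_beta1 i : tau i * beta < 1. Proof. by have /andP[] := tau_beta i. Qed.

Lemma tr_P : P^T = P :> 'M[R]_(full_dim m n p).
Proof. exact: tr_Gamma. Qed.

(** Both proximal steps have the same optimality condition, at the old and at
    the new dual variable. *)
Lemma subgradient_disa_prox (a b c : vec) :
  prox (invmx (Gamma tau)) (Gsum g) (forward_step W U f tau a b) c ->
  subgradient (Gsum g) c (P *m (a - c) - gradF a - B^T *m b).
Proof.
rewrite invmx_Gamma // => /(subgradient_prox tr_P) h.
have -> : P *m (a - c) - gradF a - B^T *m b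
    = P *m (forward_step W U f tau a b - c).
  rewrite /forward_step !mulmxBr !mulmxA mulGammaV // !mul1mx.
  by rewrite [RHS]addrAC; congr (_ - _); rewrite addrAC.
apply: h; [exact: Gsum_gt_ninfty|exact: Gsum_convex|exact: Gsum_proper].
Qed.

Lemma disa_dual_step k : Q *m (y k.+1 - y k) = B *m xbar k.+1.
Proof.
apply: argmin_quadratic; first exact: tr_Qmx.
move=> z; have := disa_y disa k z.
by rewrite -!dot_mulmx !(dotC _ (B *m _)).
Qed.

Lemma finite_lower_bound (a : 'I_m -> R) : (forall i, 0 < a i) ->
  exists2 c, 0 < c & forall i, c <= a i.
Proof.
move=> a0; exists (\big[Num.min/1]_i a i); first exact: lt_bigmin.
by move=> i; exact: bigmin_le.
Qed.

(** The coefficients left over in the energy estimate are all positive: the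
    step-size condition gives the last one, and the positive diagonal of [W] the
    first. *)
Lemma energy_constant : exists2 c, 0 < c & forall i,
  [/\ c <= beta^-1 * W i i, c <= tau i, c <= (tau i)^-1
    & c <= (tau i)^-1 - L i / 2].
Proof.
have [i|c c0 cP] := @finite_lower_bound (fun i => Num.min
    (Num.min (beta^-1 * W i i) (tau i)) ((tau i)^-1 - L i / 2)).
  have [t0 t2] := andP (tau_step i).
  rewrite !lt_min tau_gt0 andbT mulr_gt0 ?invr_gt0 ?(mix_pos W_mixing) ?subr_gt0 //=;
    last by left.
  by rewrite -[ltLHS]invrK ltf_pV2 ?posrE ?invr_gt0 ?divr_gt0 // invf_div.
exists c => // i; move: (cP i); rewrite !le_min => /andP[/andP[h1 h2] h3].
split=> //; apply: le_trans h3 _; rewrite gerBl; have := L_gt0 i; lra.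
Qed.

Lemma block_lower_bound c (a b : 'I_m -> R) (d : vec) :
  (forall i, c <= a i) -> (forall i, c <= b i) ->
  c * dot d d <= \sum_i a i * dot (submxcol (usubmx d) i) (submxcol (usubmx d) i)
                 + \sum_i b i * dot (submxcol (dsubmx d) i) (submxcol (dsubmx d) i).
Proof.
move=> ca cb; rewrite dot_usubmx_dsubmx !dot_submxcol mulrDr !mulr_sumr.
by rewrite lerD // ler_sum // => i _; rewrite ler_wpM2r ?dot_ge0.
Qed.

Lemma P_ge0 (z : vec) : 0 <= wnorm2 P z.
Proof.
rewrite wnorm2_Gamma !wnorm2_Gamma1.
by rewrite addr_ge0 // sumr_ge0 // => i _; rewrite mulr_ge0 ?dot_ge0 ?invr_ge0 ?ltW.
Qed.

Lemma P_coercive c (z : vec) : (forall i, c <= (tau i)^-1) ->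
  c * dot z z <= wnorm2 P z.
Proof.
by move=> cP; rewrite wnorm2_Gamma !wnorm2_Gamma1; exact: block_lower_bound.
Qed.

Lemma Q_coercive c (z : vec) : (forall i, c <= beta^-1 * W i i) ->
  (forall i, c <= tau i) -> c * dot z z <= wnorm2 Q z.
Proof.
move=> cW ct; apply: le_trans (Qmx_dominates W_mixing beta_gt0 tau_beta1 z).
rewrite -addrA; apply: le_trans (block_lower_bound z cW ct) _.
rewrite lerDr wnorm2_Gamma !wnorm2_Gamma1.
by rewrite addr_ge0 // sumr_ge0 // => i _; rewrite mulr_ge0 ?dot_ge0 ?ltW.
Qed.

Definition energy (w : vec * vec) k : R :=
  wnorm2 P (x k - w.1) + wnorm2 Q (y k - w.2).

(** The cross term in [xbar - x'] of [energy_step] is absorbed by Young's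
    inequality and [Qmx_dominates], the gradient term by cocoercivity. *)
Lemma energy_decrease c w k :
  (forall i, [/\ c <= beta^-1 * W i i, c <= tau i, c <= (tau i)^-1
    & c <= (tau i)^-1 - L i / 2]) ->
  saddle_points W U f g w ->
  energy w k.+1 + c * (dot (x k - xbar k.+1) (x k - xbar k.+1)
                       + dot (y k.+1 - y k) (y k.+1 - y k)) <= energy w k.
Proof.
move=> cP; case: w => xs ys /saddle_pointsP[Bxs xs_sub].
have step := energy_step tr_P (tr_Qmx (tau := tau) (beta := beta)(U := U))
  (subgradient_disa_prox (disa_xbar disa k)) (subgradient_disa_prox (disa_x disa k))
  xs_sub (disa_dual_step k) Bxs.
have young := @young_dual _ _ P (Gamma tau) (xbar k.+1 - x k.+1)
  (B^T *m (y k.+1 - y k)) tr_P.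
have dom := Qmx_dominates W_mixing (U := U) beta_gt0 tau_beta1 (y k.+1 - y k).
have fwd := Fsum_forward_error L_gt0 f_convex f_diff f_lip (x k) (xbar k.+1) xs.
have {}young := young (mulGammaV tau_gt0) P_ge0.
have cx := @block_lower_bound c (fun i => (tau i)^-1 - L i / 2)
  (fun i => (tau i)^-1) (x k - xbar k.+1).
have cy := @block_lower_bound c (fun i => beta^-1 * W i i) tau (y k.+1 - y k).
have {}cx := cx (fun i => let: And4 _ _ _ h := cP i in h)
                (fun i => let: And4 _ _ h _ := cP i in h).
have {}cy := cy (fun i => let: And4 h _ _ _ := cP i in h)
                (fun i => let: And4 _ h _ _ := cP i in h).
have cE (d : vec) : \sum_i ((tau i)^-1 - L i / 2)
       * dot (submxcol (usubmx d) i) (submxcol (usubmx d) i)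
     = wnorm2 (Gamma1 (fun i => (tau i)^-1)) (usubmx d)
       - \sum_i L i / 2 * dot (submxcol (usubmx d) i) (submxcol (usubmx d) i).
  by rewrite wnorm2_Gamma1 -sumrB; apply: eq_bigr => i _; rewrite mulrBl.
rewrite {}cE -(wnorm2_Gamma1 (fun i => (tau i)^-1)) addrAC -wnorm2_Gamma in cx.
rewrite /energy /= mulrDr; lra.
Qed.

(** The dissipation vanishes, so [xbar (k + 1)] has the same limit as [x k], and
    the optimality conditions of the dual and of the first proximal step pass to
    the limit as feasibility and stationarity. *)
Lemma disa_cluster_saddle (F : set_system nat) (a b : vec) :
  ProperFilter F -> \oo `<=` F -> saddle_points W U f g !=set0 ->
  x @ F --> a -> y @ F --> b -> saddle_points W U f g (a, b).
Proof.
move=> FP ooF [w0 sad0] xa yb; have [c c0 cP] := energy_constant.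
pose D k := dot (x k - xbar k.+1) (x k - xbar k.+1)
            + dot (y k.+1 - y k) (y k.+1 - y k).
have DF : D @ F --> (0 : R).
  have : (fun k => c * D k) @ \oo --> (0 : R).
    apply: (@decrease_cvg0 _ (energy w0)) => k.
    - rewrite addr_ge0 ?P_ge0 //; apply: le_trans (@Q_coercive c _ _ _).
      + by rewrite mulr_ge0 ?dot_ge0 ?ltW.
      + by move=> i; have [] := cP i.
      + by move=> i; have [] := cP i.
    - by rewrite mulr_ge0 ?(ltW c0) // addr_ge0 ?dot_ge0.
    - exact: energy_decrease.
  move=> cD; have cDF : (fun k => c * D k) @ F --> (0 : R).
    by apply: cvg_trans cD => S; exact: ooF.
  have -> : D = fun k => c^-1 * (c * D k).
    by apply/funext => k; rewrite mulKf ?gt_eqF.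
  by rewrite -(mulr0 c^-1); apply: cvgM => //; exact: cvg_cst.
have dx : (fun k => x k - xbar k.+1) @ F --> (0 : vec).
  by apply: cvg_of_sqr_dist DF => k; rewrite subr0 lerDl dot_ge0.
have dy : (fun k => y k.+1 - y k) @ F --> (0 : vec).
  by apply: cvg_of_sqr_dist DF => k; rewrite subr0 lerDr dot_ge0.
have xba : (fun k => xbar k.+1) @ F --> a.
  have -> : (fun k => xbar k.+1) = fun k => x k - (x k - xbar k.+1).
    by apply/funext => k; rewrite subKr.
  by rewrite -(subr0 a); apply: cvgB.
apply/saddle_pointsP; split.
  have : (fun k => Q *m (y k.+1 - y k)) @ F --> Q *m (0 : vec) by exact: cvg_mulmx.
  have -> : (fun k => Q *m (y k.+1 - y k)) = fun k => B *m xbar k.+1.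
    by apply/funext => k; exact: disa_dual_step.
  rewrite mulmx0 => lim0.
  apply: (@cvg_unique _ (@norm_hausdorff _ _) ((fun k => B *m xbar k.+1) @ F)) lim0.
  exact: cvg_mulmx.
apply: (subgradient_Gsum_limit g_cpc FP
  (fun k => subgradient_disa_prox (disa_xbar disa k)) xba).
have -> : - gradF a - B^T *m b = P *m (0 : vec) - gradF a - B^T *m b.
  by rewrite mulmx0 sub0r.
apply: cvgB; last exact: cvg_mulmx.
apply: cvgB; first exact: cvg_mulmx.
exact: cvg_gradient_Fsum.
Qed.

Lemma disa_cvg : saddle_points W U f g !=set0 ->
  exists w, [/\ saddle_points W U f g w, x @ \oo --> w.1 & y @ \oo --> w.2].
Proof.
move=> sad; have [c c0 cP] := energy_constant.
apply: (@fejer_cvg _ _ P Q c) => //.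
- by move=> z; apply: P_coercive => i; have [] := cP i.
- by move=> z; apply: Q_coercive => i; have [] := cP i.
- move=> w sw k; apply: le_trans (energy_decrease k cP sw).
  by rewrite lerDl mulr_ge0 ?(ltW c0) // addr_ge0 ?dot_ge0.
- by move=> F FP ooF a b; exact: disa_cluster_saddle.
Qed.

End Convergence.

Theorem theorem1 (R : realType) (m n p : nat) (m_gt0 : (0 < m)%N)
  (e : rel 'I_m) (W : 'M[R]_m) (U : 'I_m -> 'M[R]_(p, n))
  (f : 'I_m -> 'cV[R]_n -> R) (g : 'I_m -> 'cV[R]_p -> \bar R)
  (L tau : 'I_m -> R) (beta : R)
  (x xbar y : nat -> 'cV[R]_(full_dim m n p))
  (e_graph : connected_graph e)
  (W_mixing : mixing_matrix e W)
  (L_gt0 : forall i, 0 < L i)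
  (saddle_exists : saddle_points W U f g !=set0)
  (f_convex : forall i, convex_function setT (f i))
  (f_diff : forall i v, differentiable (f i) v)
  (f_lip : forall i, lipschitz_gradient (L i) (f i))
  (g_cpc : forall i, convex_proper_closed (g i))
  (beta_gt0 : 0 < beta)
  (tau_step : forall i, 0 < tau i < 2 / L i)
  (tau_beta : forall i, 0 < tau i * beta < 1)
  (disa : DISA_sequence W U f g tau beta x xbar y) :
  (exists w : 'cV[R]_(full_dim m n p) * 'cV[R]_(full_dim m n p),
     saddle_points W U f g w /\ (fun k => (x k, y k)) @ \oo --> w) /\
  (exists v : 'cV[R]_n,
     (fun k => usubmx (x k)) @ \oo --> \mxcol_(i < m) v /\
     argmin (primal_objective U f g) v).
Proof.
have [w [sadw xw yw]] := disa_cvg W_mixing L_gt0 f_convex f_diff f_lip g_cpc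
  beta_gt0 tau_step tau_beta disa saddle_exists.
case: w sadw xw yw => a b sadw xw yw.
split; first by exists (a, b); split=> //; exact: (cvg_pair xw yw).
have [v [av vopt]] := saddle_point_solution W_mixing L_gt0 f_convex f_diff f_lip
  g_cpc m_gt0 sadw.
by exists v; split=> //; rewrite -av; exact: cvg_usubmx.
Qed.
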